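(* For every constant $0<\varepsilon<1$ there are constants (implicit in the $\Omega(\cdot)$ and $\Theta(\cdot)$ below, depending only on $\varepsilon$) such that for every sufficiently large $n$ there is an instance of \textsc{Shallow-Light Steiner Network} on $n$ vertices for which, with $r=n^{\Omega(\varepsilon)}$, the integrality gap of the $r$-th level Lasserre SDP (defined in the context) is at least $n^{\frac{1}{16}-\Theta(\varepsilon)}$.
   Context: \textsc{Shallow-Light Steiner Network}: given an undirected graph $G=(V,E)$, a distance bound $L$, and pairs $\{s_1,t_1\},\dots,\{s_p,t_p\}$, find $S\subseteq E$ of minimum size such that for every $i\in[p]$ the graph $(V,S)$ contains an $s_i$-$t_i$ path with at most $L$ edges. For $u,v\in V$ let $\mathcal P_{u,v}$ be the set of $u$-$v$ paths in $G$ with at most $L$ edges, and $\mathcal Z^{u,v}=\{\mathbf z\in[0,1]^{E}:\sum_{e\in P}z_e\ge1\ \forall P\in\mathcal P_{u,v}\}$. The $r$-th level Lasserre SDP has a variable $y_I\in[0,1]$ for each $I\subseteq E$ and is: minimize $\sum_{e\in E}y_{\{e\}}$ subject to $y_\varnothing=1$; $M_{r+1}(y)=(y_{I\cup J})_{|I|,|J|\le r+1}\succeq 0$; and for every $i\in[p]$ and every $\mathbf z\in\mathcal Z^{s_i,t_i}$, $M^{\mathbf z}_r(y)=\left(\sum_{e\in E}z_e y_{I\cup J\cup\{e\}}-y_{I\cup J}\right)_{|I|,|J|\le r}\succeq 0$. The integrality gap on an instance is the ratio of the minimum size of a feasible $S$ to the optimal SDP value. *)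

(* Defs.v *)
From HB Require Import structures.
From mathcomp Require Import all_boot all_order all_algebra.
From mathcomp Require Import all_classical all_reals all_analysis.
Set Implicit Arguments. Unset Strict Implicit. Unset Printing Implicit Defensive.
Import Order.TTheory GRing.Theory Num.Theory.
Local Open Scope ring_scope.

Section SLSN.
Variable R : realType.
Variable V : finType.
Variable E : {set {set V}}.

Definition simple_graph : Prop := forall e, e \in E -> #|e| = 2%N.

Definition edge := {e : {set V} | e \in E}.

Definition adjE : rel V := fun a b => [set a; b] \in E.
Definition adjS (S : {set edge}) : rel V :=
  fun a b => [exists e in S, val e == [set a; b]].

Definition short_path (adj : rel V) (L : nat) (s t : V) (p : seq V) : bool :=
  [&& path adj s p, last s p == t, uniq (s :: p) & (size p <= L)%N].

Definition path_edges (s : V) (p : seq V) : {set edge} :=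
  [set e : edge | has (fun ab => val e == [set ab.1; ab.2]) (zip (s :: p) p)].

Definition inZ (L : nat) (s t : V) (z : edge -> R) : Prop :=
  (forall e, 0 <= z e <= 1) /\
  (forall p, short_path adjE L s t p -> 1 <= \sum_(e in path_edges s p) z e).

Definition psd_upto (k : nat) (M : {set edge} -> {set edge} -> R) : Prop :=
  forall x : {set edge} -> R,
    0 <= \sum_(I : {set edge} | (#|I| <= k)%N)
           \sum_(J : {set edge} | (#|J| <= k)%N) x I * M I J * x J.

Definition lasserre_feasible (r L : nat) (pairs : seq (V * V))
    (y : {set edge} -> R) : Prop :=
  [/\ forall I, 0 <= y I <= 1,
      y finset.set0 = 1,
      psd_upto r.+1 (fun I J => y (I :|: J)) &
      forall st, st \in pairs -> forall z, inZ L st.1 st.2 z ->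
        psd_upto r (fun I J => \sum_(e : edge) z e * y (e |: (I :|: J)) - y (I :|: J))].

Definition lasserre_value (r L : nat) (pairs : seq (V * V)) : R :=
  inf [set v : R | exists y, lasserre_feasible r L pairs y /\
                             v = \sum_(e : edge) y [set e]].

Definition slsn_feasible (L : nat) (pairs : seq (V * V)) (S : {set edge}) : Prop :=
  forall st, st \in pairs -> exists p, short_path (adjS S) L st.1 st.2 p.

Definition slsn_opt (L : nat) (pairs : seq (V * V)) : R :=
  inf [set v : R | exists S, slsn_feasible L pairs S /\ v = (#|S|)%:R].

Definition integrality_gap (r L : nat) (pairs : seq (V * V)) : R :=
  slsn_opt L pairs / lasserre_value r L pairs.

End SLSN.
Arguments slsn_feasible [V] E L pairs S.

(* Main.v *)
Require Import Defs.
From HB Require Import structures.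
From mathcomp Require Import all_boot all_order all_algebra all_field.
From mathcomp Require Import all_classical all_reals all_analysis.
From mathcomp Require Import zify ring lra.
(* Repeated so that [setX], [setT], [subsetP] and the like are those on finite
   sets, which classical_sets shadows. *)
From mathcomp Require Import fintype finset.
Set Implicit Arguments. Unset Strict Implicit. Unset Printing Implicit Defensive.
Import Order.TTheory GRing.Theory Num.Theory.
Local Open Scope ring_scope.

(* A random label cover game.  Its variables are the pairs [(i, w)] with [i] in
   a field [F] of order [q] and [w] in [W], with values in [F].  A constraint
   [c] picks one variable [(i, scope c i)] for every [i] and asks the values to
   form a quadratic polynomial in [i], up to a random shift.

   The code of quadratic polynomials has dual distance 4, so a sum of few dual
   words whose scopes expand well has large support.  Hence parity information
   on a few constraints is derivable from few constraints or not at all; giving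
   the derivable characters their forced sign and the others 0 yields a
   positive semidefinite pseudo-expectation in which every constraint holds.
   It is real because [F] has characteristic 2.  Conversely, an exponential
   moment bound shows that [t] labels per variable let a codeword agree with
   only about [t] coordinates of its constraint, up to a logarithm, so that
   the labels cost about [sqrt q] per variable or constraint instead of 1.

   The graph has [L = 3]: source (c, j) - codeword (c, p) - label (v, y) -
   target (v, j).  The [q] replicas [j] make the edges between codewords and
   labels negligible.  With [q = u^50], [#|W| = u^182] and [u^232] constraints
   there are about [n = u^382] vertices, the gap is [u^24 / 3], and [u] levels
   are fooled; since [24/382 > 1/16], no loss in [eps] is needed. *)

(** * Quadratic codewords and label cover games *)

Definition quad_eval (F : finFieldType) (p : F * F * F) (i : F) : F :=
  p.1.1 + p.1.2 * i + p.2 * i ^+ 2.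

(** A finite type, so that probabilities are proportions of games and union bounds are inequalities
    between cardinalities. *)
Definition game (F W : finType) (m : nat) := {ffun 'I_m -> {ffun F -> W * F}}.

Section Game.
Variables (F : finFieldType) (W : finType) (m : nat) (g : game F W m).

Definition scope (c : 'I_m) (i : F) : W := (g c i).1.
Definition shift (c : 'I_m) (i : F) : F := (g c i).2.

Definition nbr (T : {set 'I_m}) : {set F * W} :=
  [set v | [exists c in T, scope c v.1 == v.2]].

(* The constant 15/8 < 2 is half of the dual distance 4 of the code of
   quadratic polynomials, minus a slack of 1/8. *)
Definition expanding (S : nat) : Prop := forall T : {set 'I_m},
  (#|T| <= S -> 8 * (#|F| * #|T|) <= 8 * #|nbr T| + 15 * #|T|)%N.

Definition hits (T : {set F * W * F}) (c : 'I_m) (p : F * F * F) : nat :=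
  #|[set i | (i, scope c i, quad_eval p i + shift c i) \in T]|.

(** [T] may hold several labels per variable, and [p] is an arbitrary choice of codewords, in
    particular the best one for each constraint. *)
Definition sound (tau h : nat) : Prop :=
  forall (T : {set F * W * F}) (p : 'I_m -> F * F * F),
  (#|T| <= tau -> \sum_c hits T c (p c) <= m * h)%N.

End Game.

(** * Random games expand *)

Section ExpandingCount.
Variables (F : finFieldType) (W : finType) (m : nat).
Local Notation game := (game F W m).

Definition collisions (g : game) (T : {set 'I_m}) : {set 'I_m * F} :=
  [set ci | (ci.1 \in T) &&
     [exists c' in T, (c' < ci.1)%N && (scope g c' ci.2 == scope g ci.1 ci.2)]].

(** Positions outside [collisions] touch distinct variables: of two constraints sharing a variable,
    the one of larger index makes a collision. *)
Lemma card_nbr_collisions (g : game) (T : {set 'I_m}) :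
  (#|F| * #|T| <= #|nbr g T| + #|collisions g T|)%N.
Proof.
pose D := setX T [set: F] :\: collisions g T.
have sC : collisions g T \subset setX T [set: F].
  by apply/subsetP => -[c i]; rewrite !inE /= => /andP[-> _].
have cD : (#|D| + #|collisions g T| = #|F| * #|T|)%N.
  rewrite cardsD (setIidPr sC) subnK ?subset_leq_card // cardsX cardsT.
  by rewrite mulnC.
rewrite -cD leq_add2r.
pose h (ci : 'I_m * F) := (ci.2, scope g ci.1 ci.2).
have hinj : {in D &, injective h}.
  have lem c c' i : (c, i) \in D -> (c', i) \in D ->
      scope g c i = scope g c' i -> ~~ (c' < c)%N.
    rewrite !inE /= => /andP[ncoll /andP[cT _]] /andP[_ /andP[c'T _]] eqs.
    apply: contra ncoll => lt; rewrite cT /=.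
    by apply/existsP; exists c'; rewrite c'T lt eqs eqxx.
  move=> [c i] [c' i'] D1 D2 [] eqi; rewrite /= in eqi; subst i' => eqs.
  have h1 := lem _ _ _ D1 D2 eqs; have h2 := lem _ _ _ D2 D1 (esym eqs).
  have -> // : c = c' by apply: ord_inj; lia.
rewrite -(card_in_imset hinj); apply/subset_leq_card/subsetP => v.
case/imsetP => -[c i]; rewrite !inE /= => /andP[_ /andP[cT _]] ->.
by apply/existsP; exists c; rewrite cT /= eqxx.
Qed.

(** Each [t k] prescribes one collision: [(t k).1] is its position and [(t k).2] the constraint
    whose variable is repeated there. *)
Definition collision_event e (t : {ffun 'I_e -> 'I_m * F * 'I_m}) : {set game} :=
  [set g | [forall k, scope g (t k).2 (t k).1.2 == scope g (t k).1.1 (t k).1.2]].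

(* On the event, the scopes at the positions [(t k).1] are determined by the
   others, since they point to smaller constraints; overwriting them by
   arbitrary values is therefore injective. *)
Lemma card_collision_event e (t : {ffun 'I_e -> 'I_m * F * 'I_m}) :
  injective (fun k => (t k).1) -> (forall k, (t k).2 < (t k).1.1)%N ->
  (#|collision_event t| * #|W| ^ e <= #|{: game}|)%N.
Proof.
move=> tinj tlt.
pose over (gh : game * {ffun 'I_e -> W}) : game :=
  [ffun c => [ffun i => if [pick k | (t k).1 == (c, i)] is Some k
                        then (gh.2 k, shift gh.1 c i) else gh.1 c i]].
pose D : {set game * {ffun 'I_e -> W}} := setX (collision_event t) [set: {ffun 'I_e -> W}].
have -> : (#|collision_event t| * #|W| ^ e = #|D|)%N.
  by rewrite cardsX cardsT card_ffun card_ord.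
apply: (@leq_card_in _ _ over) => -[g1 h1] [g2 h2].
rewrite !inE !andbT /= => /forallP ev1 /forallP ev2 eqo.
have overE c i : over (g1, h1) c i = over (g2, h2) c i by rewrite eqo.
have eqh : h1 = h2.
  apply/ffunP => k; have := overE (t k).1.1 (t k).1.2; rewrite !ffunE -surjective_pairing.
  by case: pickP => [k' /eqP/tinj -> []|/(_ k)] //; rewrite eqxx.
have eqg n : forall (c : 'I_m) i, (c <= n)%N -> g1 c i = g2 c i.
  elim: n => [|n IH] c i cn; have := overE c i; rewrite !ffunE.
    case: pickP => [k /eqP kE|//] _; have := tlt k; rewrite kE /=.
    by move: cn; rewrite leqn0 => /eqP ->.
  case: pickP => [k /eqP kE [_ eqs]|//].
  have := tlt k; rewrite kE /= => ltk.
  rewrite [g1 c i]surjective_pairing [g2 c i]surjective_pairing.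
  congr (_, _); last by [].
  have := ev1 k; have := ev2 k; rewrite kE /= /scope => /eqP <- /eqP <-.
  by rewrite IH // -ltnS (leq_trans ltk).
congr (_, _) => //; apply/ffunP => c; apply/ffunP => i; exact: (eqg c).
Qed.

Lemma card_bigcup_leq (I T : finType) (P : pred I) (A : I -> {set T}) :
  (#|\bigcup_(i | P i) A i| <= \sum_(i | P i) #|A i|)%N.
Proof.
elim/big_rec2: _ => [|i n B _ IH]; first by rewrite cards0.
by rewrite (leq_trans (leq_card_setU _ _)) // leq_add2l.
Qed.

Definition expansion_failure (T : {set 'I_m}) : {set game} :=
  [set g | (8 * #|nbr g T| + 15 * #|T| < 8 * (#|F| * #|T|))%N].

(** A failure has more than 15s/8 collisions, where s = #|T|. There are at most (|F| s^2)^e ways to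
    choose e = ceil(15s/8) of them with witnesses, each choice has probability at most |W|^-e, and
    the product is at most x^(-8e) <= x^(-15s). *)
Lemma card_expansion_failure (T : {set 'I_m}) (x : nat) :
  (0 < x -> #|F| * #|T| ^ 2 * x ^ 8 <= #|W| ->
  #|expansion_failure T| * x ^ (15 * #|T|) <= #|{: game}|)%N.
Proof.
move=> x0 leW; set s := #|T|.
have [s0|s_gt0] := posnP s.
  rewrite [X in (X <= _)%N](_ : _ = 0)%N //.
  apply/eqP; rewrite muln_eq0 cards_eq0; apply/orP; left; apply/eqP/setP => g.
  by rewrite !inE -/s s0 !muln0 ltn0.
pose e := ((15 * s + 7) %/ 8)%N.
have e8 : (15 * s <= 8 * e)%N by rewrite /e; lia.
pose A := [set t : {ffun 'I_e -> 'I_m * F * 'I_m} |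
  (t \in ffun_on (setX (setX T [set: F]) T)) &&
  (injectiveb (fun k => (t k).1) && [forall k, (t k).2 < (t k).1.1]%N)].
have cA : (#|A| <= (#|F| * s ^ 2) ^ e)%N.
  rewrite (_ : #|F| * s ^ 2 = #|setX (setX T [set: F]) T|)%N; last first.
    by rewrite !cardsX cardsT -/s mulnAC mulnn mulnC.
  rewrite -[X in (_ ^ X)%N](card_ord e) -card_ffun_on.
  by apply/subset_leq_card/subsetP => t; rewrite inE => /andP[].
have sub : expansion_failure T \subset \bigcup_(t in A) collision_event t.
  apply/subsetP => g; rewrite inE -/s => bad.
  have := card_nbr_collisions g T; rewrite -/s => lec.
  have leZ : (e <= #|collisions g T|)%N by rewrite /e; lia.
  have wit (ci : 'I_m * F) : {c' : 'I_m | (ci \in collisions g T) ==>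
     [&& c' \in T, c' < ci.1 & scope g c' ci.2 == scope g ci.1 ci.2]%N}.
    apply: sigW; have [|_] := boolP (ci \in collisions g T); last by exists ci.1.
    rewrite inE => /andP[_ /existsP[c' /andP[h1 h2]]].
    by exists c'; rewrite /= h1.
  have z0 (k : 'I_e) : (k < #|collisions g T|)%N by apply: leq_trans leZ.
  pose z k := enum_val (Ordinal (z0 k)).
  have zC k : z k \in collisions g T by apply: enum_valP.
  pose t := [ffun k => (z k, sval (wit (z k)))].
  have tP k : [&& (t k).2 \in T, (t k).2 < (t k).1.1 &
      scope g (t k).2 (t k).1.2 == scope g (t k).1.1 (t k).1.2]%N.
    by rewrite ffunE /=; case: (wit (z k)) => c' /=; rewrite zC.
  apply/bigcupP; exists t; last first.
    by rewrite inE; apply/forallP => k; case/and3P: (tP k).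
  rewrite inE; apply/and3P; split.
  - apply/ffun_onP => k; case/and3P: (tP k) => t2 _ _; rewrite !inE t2 !andbT.
    by rewrite ffunE /=; have := zC k; rewrite inE => /andP[].
  - apply/injectiveP => k k'; rewrite !ffunE /= => /enum_val_inj/(congr1 val) /=.
    exact: ord_inj.
  - by apply/forallP => k; case/and3P: (tP k).
have leE : (#|expansion_failure T| * #|W| ^ e <= (#|F| * s ^ 2) ^ e * #|{: game}|)%N.
  apply: leq_trans (leq_mul (leq_trans (subset_leq_card sub) (card_bigcup_leq _ _)) (leqnn _)) _.
  rewrite big_distrl /= (leq_trans (n := \sum_(t in A) #|{: game}|)) //.
    apply: leq_sum => t; rewrite inE => /and3P[_ /injectiveP tinj /forallP tlt].
    exact: card_collision_event.
  by rewrite sum_nat_const leq_mul2r cA orbT.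
have P0 : (0 < (#|F| * s ^ 2) ^ e)%N.
  rewrite expn_gt0 muln_gt0 expn_gt0 s_gt0 /=.
  by rewrite (_ : 0 < #|F|)%N //; apply/card_gt0P; exists 0.
rewrite -(leq_pmul2l P0); apply: leq_trans leE.
rewrite mulnCA leq_mul2l; apply/orP; right.
apply: (leq_trans (n := ((#|F| * s ^ 2) * x ^ 8) ^ e)); last by rewrite leq_exp2r // /e; lia.
by rewrite [X in (_ <= X)%N]expnMn leq_mul2l -expnM leq_pexp2l ?orbT.
Qed.

Lemma bin_leq_expn n k : ('C(n, k) <= n ^ k)%N.
Proof.
have ffact_le : forall k n, (n ^_ k <= n ^ k)%N.
  elim=> [|j IH] a; first by rewrite ffactn0.
  rewrite ffactnS expnS leq_mul2l (leq_trans (IH _)) ?orbT //.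
  by case: j {IH} => // j; rewrite leq_exp2r // leq_pred.
by rewrite (leq_trans _ (ffact_le k n)) // -bin_ffact leq_pmulr // fact_gt0.
Qed.

(** The empty set never fails. The at most m^s sets of size s >= 1 each fail with probability at
    most x^(-15s) <= (m y)^(-s), so each of the [S] sizes contributes at most 1/y. *)
Lemma card_not_expanding (S x y : nat) :
  (0 < x -> #|F| * S ^ 2 * x ^ 8 <= #|W| -> m * y <= x ^ 15 -> 0 < y ->
  y * #|\bigcup_(T : {set 'I_m} | #|T| <= S) expansion_failure T| <=
    S * #|{: game}|)%N.
Proof.
move=> x0 leW lem y0.
have -> : \bigcup_(T : {set 'I_m} | (#|T| <= S)%N) expansion_failure T =
    \bigcup_(s < S) \bigcup_(T : {set 'I_m} | #|T| == s.+1) expansion_failure T.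
  apply/setP => g; apply/bigcupP/bigcupP => [[T TS gT]|[s _ /bigcupP[T Ts gT]]].
    have T0 : (0 < #|T|)%N.
      by rewrite lt0n; apply: contraL gT => /eqP T0; rewrite inE T0 !muln0.
    have sS : (#|T|.-1 < S)%N by rewrite prednK.
    by exists (Ordinal sS) => //; apply/bigcupP; exists T; rewrite //= prednK.
  by exists T => //; rewrite (eqP Ts).
apply: leq_trans (leq_mul (leqnn _) (card_bigcup_leq _ _)) _.
rewrite big_distrr /= -[X in (_ <= X * _)%N](card_ord S) -sum_nat_const leq_sum // => s _.
have h : (#|\bigcup_(T : {set 'I_m} | #|T| == s.+1) expansion_failure T| * x ^ (15 * s.+1) <=
    m ^ s.+1 * #|{: game}|)%N.
  apply: leq_trans (leq_mul (card_bigcup_leq _ _) (leqnn _)) _.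
  rewrite big_distrl /=.
  apply: (leq_trans (n := \sum_(T : {set 'I_m} | #|T| == s.+1) #|{: game}|)%N).
    apply: leq_sum => T /eqP Ts; rewrite -Ts; apply: card_expansion_failure => //.
    apply: leq_trans leW; apply: leq_mul => //; apply: leq_mul => //.
    by rewrite leq_exp2r // Ts; exact: ltn_ord.
  rewrite sum_nat_const leq_mul2r -[X in (X <= _)%N]cardsE card_draws card_ord.
  by rewrite bin_leq_expn orbT.
have x1 : (0 < x ^ (15 * s.+1))%N by rewrite expn_gt0 x0.
rewrite -(leq_pmul2r x1) -mulnA (leq_trans (leq_mul (leqnn _) h)) //.
rewrite mulnA [X in (_ <= X)%N]mulnC leq_mul2r; apply/orP; right.
rewrite expnM; apply: (leq_trans (n := ((m * y) ^ s.+1)%N)).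
  by rewrite expnMn mulnC leq_mul2l -[X in (X <= _)%N]expn1 leq_pexp2l ?orbT.
by rewrite leq_exp2r.
Qed.

End ExpandingCount.

(** * Random games are sound *)

Section SoundCount.
Variable R : realType.

(** The crude bound from exp(-1/2) >= 1 - 1/2 suffices and keeps the moment bound a power of 2. *)
Lemma expR1_le4 : expR 1 <= 4 :> R.
Proof.
have h : 2^-1 <= expR (- 2^-1) :> R by have := @expR_ge1Dx R (- 2^-1); lra.
have e2 : expR 2^-1 <= 2 :> R.
  rewrite -[X in _ <= X]invrK -[X in X <= _]invrK -expRN.
  by rewrite lef_pV2 // ?posrE ?expR_gt0 // invr_gt0.
have -> : (1 : R) = 2^-1 + 2^-1 by lra.
have := expR_gt0 (2^-1 : R); rewrite expRD; nra.
Qed.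

(** By 1 + x <= exp x, each factor is at most M exp(a_i / M), and the exponents add up to at most t.
    The case M = 0 is separate because of the division. *)
Lemma prod_addn_leq (I : finType) (a : I -> nat) (M t : nat) :
  (\sum_i a i <= t * M -> \prod_i (M + a i) <= M ^ #|I| * 4 ^ t)%N.
Proof.
have [->|M0 sa] := posnP M.
  rewrite muln0 leqn0 sum_nat_eq0 => /forallP a0.
  have [i0 _|I0] := pickP (@predT I).
    by rewrite (bigD1 i0) //= (eqP (a0 i0)) !mul0n.
  by rewrite big_pred0 // eq_card0 // expn0 mul1n expn_gt0.
have Mr : 0 < M%:R :> R by rewrite ltr0n.
rewrite -(ler_nat R) natr_prod natrM natrX.
apply: (le_trans (y := \prod_(i : I) (M%:R * expR ((a i)%:R / M%:R)) : R)).
  apply: ler_prod => i _; rewrite ler0n /= natrD.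
  rewrite [X in X <= _](_ : _ = M%:R * (1 + (a i)%:R / M%:R)).
    by rewrite ler_wpM2l ?ler0n ?expR_ge1Dx.
  by field; rewrite lt0r_neq0.
rewrite big_split /= prodr_const ler_wpM2l ?exprn_ge0 //.
rewrite -expR_sum -mulr_suml -natr_sum.
apply: (le_trans (y := expR t%:R)).
  by rewrite ler_expR ler_pdivrMr // -natrM ler_nat.
by rewrite -[t%:R]mulr1 expRM_natl natrX lerXn2r // ?nnegrE ?expR_ge0 ?expR1_le4.
Qed.

Variables (F : finFieldType) (W : finType) (m : nat).
Local Notation game := (game F W m).

Definition slice (T : {set F * W * F}) (i : F) : {set W * F} :=
  [set wa | (i, wa.1, wa.2) \in T].

Lemma sum_card_slice (T : {set F * W * F}) : (\sum_i #|slice T i| = #|T|)%N.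
Proof.
rewrite -[RHS]sum1_card.
rewrite (partition_big (fun x : F * W * F => x.1.1) predT) //=; apply: eq_bigr => i _.
rewrite -sum1_card (reindex_onto (fun wa : W * F => (i, wa.1, wa.2)) (fun x => (x.1.2, x.2))) /=.
  by apply: eq_bigl => -[w a]; rewrite inE /= !eqxx !andbT.
by move=> [[i' w] a] /= /andP[_ /eqP ->].
Qed.

(** Scopes and shifts are independent over all positions, so the moment factorizes. A uniform shift
    makes the label at position i uniform, which gives the factor 1 + |slice i| / (|W| |F|); the
    slices of one constraint together have size #|T|. *)
Lemma hits_moment (T : {set F * W * F}) (p : 'I_m -> F * F * F) (t : nat) :
  (#|T| <= t * (#|W| * #|F|) ->
  \sum_(g : game) 2 ^ (\sum_c hits g T c (p c)) <= #|{: game}| * 4 ^ (t * m))%N.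
Proof.
move=> cT.
have -> : (\sum_(g : game) 2 ^ (\sum_c hits g T c (p c)) =
    \prod_(c < m) \prod_(i : F)
       \sum_(wb : W * F) 2 ^ ((i, wb.1, quad_eval (p c) i + wb.2)%R \in T))%N.
  transitivity (\prod_(c < m) \sum_(f : {ffun F -> W * F})
      \prod_(i : F) 2 ^ ((i, (f i).1, quad_eval (p c) i + (f i).2)%R \in T))%N.
    rewrite bigA_distr_bigA; apply: eq_bigr => g _.
    rewrite expn_sum; apply: eq_bigr => c _; rewrite -expn_sum; congr (2 ^ _)%N.
    rewrite /hits -sum1_card big_mkcond; apply: eq_bigr => i _.
    by rewrite inE; case: (_ \in T).
  by apply: eq_bigr => c _; rewrite bigA_distr_bigA.
apply: (leq_trans (n := \prod_(c < m) \prod_(i : F) (#|W| * #|F| + #|slice T i|))%N).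
  apply: leq_prod => c _; apply: leq_prod => i _.
  have -> : (\sum_(wb : W * F) 2 ^ ((i, wb.1, quad_eval (p c) i + wb.2)%R \in T) =
     \sum_(wb : W * F) (1 + ((i, wb.1, quad_eval (p c) i + wb.2)%R \in T)))%N.
    by apply: eq_bigr => wb _; case: (_ \in T).
  rewrite big_split /= sum1_card card_prod leq_add2l.
  (* Subtracting the value of the codeword maps the slice onto the pairs of scope and shift that hit
     [T]. *)
  have := @leq_imset_card _ _ (fun wa : W * F => (wa.1, wa.2 - quad_eval (p c) i)) (slice T i).
  apply: leq_trans; rewrite -sum1_card [X in (_ <= X)%N]big_mkcond; apply: leq_sum => -[w b] _ /=.
  case: ifP => [_|/negbT nin]; first by case: (_ \in T).
  rewrite leqn0 eqb0; apply: contra nin => inT; apply/imsetP.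
  exists (w, quad_eval (p c) i + b); rewrite ?inE //=.
  by rewrite addrC addKr.
have le1 (c : 'I_m) : (\prod_(i : F) (#|W| * #|F| + #|slice T i|) <=
    (#|W| * #|F|) ^ #|F| * 4 ^ t)%N.
  by apply: prod_addn_leq; rewrite sum_card_slice.
apply: (leq_trans (n := \prod_(c < m) ((#|W| * #|F|) ^ #|F| * 4 ^ t))%N).
  by apply: leq_prod => c _; exact: le1.
by rewrite prod_nat_const card_ord expnMn -!expnM card_ffun card_ord card_ffun card_prod expnM.
Qed.

Definition soundness_failure (h : nat) (T : {set F * W * F}) (p : 'I_m -> F * F * F) :
    {set game} :=
  [set g | (m * h < \sum_c hits g T c (p c))%N].

(** Markov's inequality for 2 to the number of hits. *)
Lemma card_soundness_failure h t (T : {set F * W * F}) (p : 'I_m -> F * F * F) :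
  (#|T| <= t * (#|W| * #|F|) ->
  2 ^ (m * h) * #|soundness_failure h T p| <= #|{: game}| * 4 ^ (t * m))%N.
Proof.
move=> /hits_moment -/(_ p); apply: leq_trans.
rewrite mulnC -sum_nat_const big_mkcond leq_sum // => g _.
by case: ifP => //; rewrite inE => /ltnW lt; rewrite leq_pexp2l.
Qed.

(** Union bound over label sets and codeword choices. A label set of size at most [tau] is given by
    a function on ['I_tau], which makes the count a plain power. *)
Lemma card_not_sound h t tau :
  (tau <= t * (#|W| * #|F|) -> 2 ^ (m * h) * #|\bigcup_(f : {ffun 'I_tau -> F * W * F})
      \bigcup_(p : {ffun 'I_m -> F * F * F})
        soundness_failure h [set f k | k : 'I_tau] p| <=
  (#|F| * #|W| * #|F|) ^ tau * (#|F| ^ 3) ^ m * 4 ^ (t * m) * #|{: game}|)%N.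
Proof.
move=> le_tau.
apply: leq_trans (leq_mul (leqnn _) (card_bigcup_leq _ _)) _.
rewrite big_distrr /=.
apply: (leq_trans (n := \sum_(f : {ffun 'I_tau -> F * W * F})
   \sum_(p : {ffun 'I_m -> F * F * F}) #|{: game}| * 4 ^ (t * m))%N).
  apply: leq_sum => f _; apply: leq_trans (leq_mul (leqnn _) (card_bigcup_leq _ _)) _.
  rewrite big_distrr leq_sum //= => p _; apply: card_soundness_failure.
  by rewrite (leq_trans (leq_imset_card _ _)) // card_ord.
rewrite !sum_nat_const !card_ffun !card_ord !card_prod.
rewrite [(#|F| ^ 3)%N]expnSr -mulnn.
by rewrite !mulnA [X in (_ <= X)%N]mulnAC.
Qed.

Lemma not_sound_failure (g : game) h tau : (0 < #|W|)%N ->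
  ~ sound g tau h -> g \in \bigcup_(f : {ffun 'I_tau -> F * W * F})
      \bigcup_(p : {ffun 'I_m -> F * F * F})
        soundness_failure h [set f k | k : 'I_tau] p.
Proof.
move=> /card_gt0P[w0 _] ns; apply/negPn/negP => nin; apply: ns => T p cT.
(* The enumeration of [T] is padded with a dummy label; the image then contains [T], and additional
   labels can only increase the hits. *)
pose f := [ffun k : 'I_tau => nth (0, w0, 0) (enum T) k].
pose p' := finfun p.
rewrite leqNgt; apply: contra nin => lt.
apply/bigcupP; exists f => //; apply/bigcupP; exists p' => //.
rewrite inE (leq_trans lt) //; apply: leq_sum => c _; rewrite ffunE.
apply/subset_leq_card/subsetP => i; rewrite !inE => iT; apply/imsetP.
have lti : (index (i, scope g c i, (quad_eval (p c) i + shift g c i)%R) (enum T) < tau)%N.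
  by apply: leq_trans cT; rewrite cardE index_mem mem_enum.
by exists (Ordinal lti); rewrite // ffunE /= nth_index // mem_enum.
Qed.

(** Each of the two kinds of failure takes up at most a quarter of all games. *)
Theorem game_exists (S x y h t : nat) :
  (0 < #|W| -> 0 < x -> #|F| * S ^ 2 * x ^ 8 <= #|W| -> m * y <= x ^ 15 -> 4 * S <= y -> 0 < y ->
  4 * ((#|F| * #|W| * #|F|) ^ (t * (#|W| * #|F|)) * (#|F| ^ 3) ^ m * 4 ^ (t * m))
    <= 2 ^ (m * h) ->
  exists g : game, expanding g S /\ sound g (t * (#|W| * #|F|)) h)%N.
Proof.
move=> W0 x0 leW lem leS y0 leh; set tau := (t * _)%N.
pose B1 : {set game} := \bigcup_(T : {set 'I_m} | (#|T| <= S)%N) expansion_failure F W T.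
pose B2 := \bigcup_(f : {ffun 'I_tau -> F * W * F})
      \bigcup_(p : {ffun 'I_m -> F * F * F})
        soundness_failure h [set f k | k : 'I_tau] p.
have G0 : (0 < #|{: game}|)%N.
  rewrite !card_ffun !expn_gt0 card_prod muln_gt0 W0 /=.
  by apply/orP; left; apply/orP; left; apply/card_gt0P; exists 0.
have b1 : (4 * #|B1| <= #|{: game}|)%N.
  have := card_not_expanding x0 leW lem y0; rewrite -/B1 => b1.
  rewrite -(leq_pmul2l y0); apply: leq_trans (leq_mul leS (leqnn _)).
  by rewrite mulnCA -mulnA leq_mul2l b1 orbT.
have b2 : (4 * #|B2| <= #|{: game}|)%N.
  have := card_not_sound h (leqnn tau); rewrite -/B2 => b2.
  have H0 : (0 < 2 ^ (m * h))%N by rewrite expn_gt0.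
  rewrite -(leq_pmul2l H0); apply: leq_trans (leq_mul leh (leqnn _)).
  by rewrite mulnCA -mulnA leq_mul2l b2 orbT.
have : (#|B1 :|: B2| < #|{: game}|)%N.
  apply: leq_ltn_trans (leq_card_setU _ _) _.
  move: b1 b2 G0; move: #|B1| #|B2| #|{: game}| => a b c; lia.
rewrite -subn_gt0 -(cardsC (B1 :|: B2)) addKn => /card_gt0P[g].
rewrite !inE negb_or => /andP[n1 n2]; exists g; split.
  move=> T TS; rewrite leqNgt; apply: contra n1 => bad.
  by apply/bigcupP; exists T; rewrite ?inE.
by apply: contrapT => /(not_sound_failure W0); rewrite (negbTE n2).
Qed.
End SoundCount.

(** * Characters *)

Section PsdKernel.
Variables (R : realType) (T : finType) (P : pred T) (k : T -> T -> R).
Hypothesis k_refl : forall a, P a -> k a a = 1.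
Hypothesis k_sym : forall a b, k a b = k b a.
Hypothesis k_mul : forall a b c, P a -> P b -> P c ->
  k a b != 0 -> k b c != 0 -> k a c = k a b * k b c.

(* Such a kernel is block-diagonal with rank-one blocks: row [b] is
   proportional to each of the rows of its class, whose size is [N b]. *)
Lemma psd_kernel (f : T -> R) :
  0 <= \sum_(a | P a) \sum_(b | P b) f a * f b * k a b.
Proof.
pose N b := \sum_(a | P a) k b a ^+ 2.
have sq1 a b : P a -> P b -> k a b != 0 -> k a b ^+ 2 = 1.
  by move=> Pa Pb nz; rewrite expr2 {2}k_sym -k_mul ?k_refl // k_sym.
have nz_tr a b c : P a -> P b -> P c -> k a b != 0 -> k b c != 0 -> k a c != 0.
  by move=> Pa Pb Pc h1 h2; rewrite (k_mul Pa Pb Pc) // mulf_neq0.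
have N_gt0 b : P b -> 0 < N b.
  move=> Pb; rewrite /N (bigD1 b) //= k_refl // expr1n ltr_pwDl // sumr_ge0 //.
  by move=> a _; rewrite sqr_ge0.
have N_eq a b : P a -> P b -> k a b != 0 -> N a = N b.
  move=> Pa Pb nz; apply: eq_bigr => d Pd.
  have [bd0|bd] := eqVneq (k b d) 0.
    suff -> : k a d = 0 by rewrite bd0.
    apply: contra_eq bd0 => ad; apply: nz_tr ad => //; by rewrite k_sym.
  by rewrite (k_mul Pa Pb Pd) // exprMn (sq1 a b) ?mul1r.
(* This writes the kernel as a positive combination of rank-one kernels: in a class of size N, each
   of its N rows contributes the same block. *)
have kE a c : P a -> P c -> k a c = \sum_(b | P b) (N b)^-1 * (k b a * k b c).
  move=> Pa Pc.
  have [ac0|ac] := eqVneq (k a c) 0.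
    rewrite ac0 big1 // => b Pb.
    have [->|ba] := eqVneq (k b a) 0; first by rewrite mul0r mulr0.
    have [->|bc] := eqVneq (k b c) 0; first by rewrite !mulr0.
    have : k a c != 0 by apply: nz_tr bc => //; rewrite k_sym.
    by rewrite ac0 eqxx.
  transitivity (\sum_(b | P b) (N a)^-1 * (k a b ^+ 2 * k a c)).
    rewrite -mulr_sumr -mulr_suml -/(N a) mulrA mulVf ?mul1r //.
    by rewrite gt_eqF // N_gt0.
  apply: eq_bigr => b Pb; rewrite [k b a]k_sym.
  have [->|ab] := eqVneq (k a b) 0; first by rewrite expr0n /= !mul0r !mulr0.
  by rewrite -(N_eq a b) // (k_mul Pb Pa Pc) ?[k b a]k_sym // mulrA expr2.
have -> : \sum_(a | P a) \sum_(b | P b) f a * f b * k a b =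
    \sum_(d | P d) (N d)^-1 * (\sum_(a | P a) f a * k d a) ^+ 2.
  transitivity (\sum_(a | P a) \sum_(b | P b) \sum_(d | P d)
      (N d)^-1 * ((f a * k d a) * (f b * k d b))).
    apply: eq_bigr => a Pa; apply: eq_bigr => b Pb; rewrite kE // mulr_sumr.
    by apply: eq_bigr => d _; ring.
  under eq_bigr do rewrite exchange_big /=.
  rewrite exchange_big /=; apply: eq_bigr => d Pd.
  rewrite expr2 mulr_suml mulr_sumr; apply: eq_bigr => a Pa.
  by rewrite !mulr_sumr.
by apply: sumr_ge0 => d Pd; rewrite mulr_ge0 ?sqr_ge0 // invr_ge0 ltW ?N_gt0.
Qed.

End PsdKernel.

(** * Orthogonality for additive characters with values 1 and -1 *)

Section Characters.
Variables (R : realType) (F : finFieldType) (psi : F -> R).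
Hypothesis psiD : forall x y, psi (x + y) = psi x * psi y.
Hypothesis psi_sq : forall x, psi x ^+ 2 = 1.
Hypothesis psi_sum : \sum_x psi x = 0.

Lemma psi0 : psi 0 = 1.
Proof.
have nz : psi 0 != 0.
  by apply/eqP => z; have := psi_sq 0; rewrite z expr0n /= => /esym/eqP; rewrite oner_eq0.
by apply: (mulfI nz); rewrite -psiD addr0 mulr1.
Qed.

Lemma psi_neq0 x : psi x != 0.
Proof.
by apply/eqP => z; have := psi_sq x; rewrite z expr0n /= => /esym/eqP; rewrite oner_eq0.
Qed.

Lemma psiN x : psi (- x) = psi x.
Proof.
by apply: (mulfI (psi_neq0 x)); rewrite -psiD subrr psi0 -expr2 psi_sq.
Qed.

Lemma psiB x y : psi (x - y) = psi x * psi y.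
Proof. by rewrite psiD psiN. Qed.

Lemma psi_bigsum (I : Type) (s : seq I) (P : pred I) (f : I -> F) :
  psi (\sum_(i <- s | P i) f i) = \prod_(i <- s | P i) psi (f i).
Proof. exact: (big_morph psi psiD psi0). Qed.

Lemma sum_psi_mul (a : F) : \sum_x psi (a * x) = (#|F| * (a == 0))%:R.
Proof.
have [->|nz] := eqVneq a 0.
  under eq_bigr do rewrite mul0r psi0.
  by rewrite sumr_const muln1.
rewrite muln0 -[RHS]psi_sum [RHS](reindex_inj (mulfI nz)).
by [].
Qed.

Lemma sum_psi_ffun (I : finType) (a : {ffun I -> F}) :
  \sum_(x : {ffun I -> F}) psi (\sum_i a i * x i) = (#|F| ^ #|I| * (a == 0))%:R.
Proof.
under eq_bigr do rewrite psi_bigsum.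
rewrite -(bigA_distr_bigA (fun i y => psi (a i * y))).
under eq_bigr do rewrite sum_psi_mul.
have [->|nz] := eqVneq a 0.
  under eq_bigr do rewrite ffunE eqxx muln1.
  by rewrite prodr_const muln1 natrX.
have [i ai] : exists i, a i != 0.
  apply/existsP; apply: contraNT nz; rewrite negb_exists => /forallP a0.
  by apply/eqP/ffunP => i; rewrite ffunE; apply/eqP; rewrite -[_ == _]negbK.
by rewrite (bigD1 i) //= (negbTE ai) !muln0 mul0r.
Qed.

End Characters.

(** * Derivable characters *)

Section Derivations.
Variables (F : finFieldType) (W : finType) (m : nat) (g : game F W m).
Local Notation var := (F * W)%type.
Local Notation chr := {ffun var -> F}.
Local Notation scope := (scope g).
Local Notation shift := (shift g).
Local Notation nbr := (nbr g).

Definition dual_word (b : {ffun F -> F}) : bool :=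
  [forall p, \sum_i b i * quad_eval p i == 0].

Definition lift_word (c : 'I_m) (b : {ffun F -> F}) : chr :=
  [ffun v => if scope c v.1 == v.2 then b v.1 else 0].

Local Notation family := {ffun 'I_m -> {ffun F -> F}}.

Definition supp_family (B : family) : {set 'I_m} := [set c | B c != 0].

Definition derives (s : nat) (B : family) (a : chr) : bool :=
  [&& [forall c, dual_word (B c)], \sum_c lift_word c (B c) == a &
      (#|supp_family B| <= s)%N].

(** The value forced on the linear form [a] when [B] derives it: on satisfied constraints the
    codewords vanish against dual words and only the shifts remain. *)
Definition family_value (B : family) : F := \sum_c \sum_i B c i * shift c i.

(** The notion of degree: the whole scope of a constraint counts as one, just as a single variable
    does, since a single edge event may fix all its values. *)
Definition small (n : nat) (a : chr) : bool :=
  [exists IV : {set 'I_m} * {set var}, (#|IV.1| + #|IV.2| <= n)%N &&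
     [forall v, (a v != 0) ==> (v \in IV.2) || (v \in nbr IV.1)]].

Lemma smallP n (a : chr) : reflect
  (exists (I : {set 'I_m}) (V : {set var}), (#|I| + #|V| <= n)%N /\
     forall v, a v != 0 -> (v \in V) || (v \in nbr I)) (small n a).
Proof.
apply: (iffP existsP) => [[[I V] /andP[le /forallP sub]]|[I [V [le sub]]]].
  by exists I, V; split => // v; apply/implyP.
by exists (I, V); rewrite le; apply/forallP => v; apply/implyP/sub.
Qed.

Lemma nbrU (I J : {set 'I_m}) : nbr (I :|: J) = nbr I :|: nbr J.
Proof.
apply/setP => v; rewrite !inE; apply/existsP/orP.
  case=> c; rewrite !inE => /andP[/orP[cI|cJ] h]; [left|right];
  by apply/existsP; exists c; rewrite h ?cI ?cJ.
by case=> /existsP[c /andP[cI h]]; exists c; rewrite inE cI h ?orbT.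
Qed.

Lemma small0 n : small n 0.
Proof.
apply/smallP; exists set0, set0; rewrite !cards0; split => // v.
by rewrite ffunE eqxx.
Qed.

Lemma small_leq n1 n2 a : (n1 <= n2)%N -> small n1 a -> small n2 a.
Proof.
move=> le /smallP[I [V [leI sub]]]; apply/smallP; exists I, V; split => //.
exact: leq_trans le.
Qed.

Lemma smallD n1 n2 a b : small n1 a -> small n2 b -> small (n1 + n2) (a + b).
Proof.
move=> /smallP[I [V [le sub]]] /smallP[I' [V' [le' sub']]].
apply/smallP; exists (I :|: I'), (V :|: V'); split.
  have := (leq_card_setU I I').1; have := (leq_card_setU V V').1; move: le le'.
  by move: #|V :|: V'| #|I :|: I'| #|V| #|V'| #|I| #|I'| => *; lia.
move=> v; rewrite ffunE nbrU !in_setU => nz.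
have [a0|/sub/orP[]->] := eqVneq (a v) 0; rewrite ?orbT //.
by move: nz; rewrite a0 add0r => /sub'/orP[]->; rewrite ?orbT.
Qed.

Lemma smallN n a : small n a -> small n (- a).
Proof.
move=> /smallP[I [V [le sub]]]; apply/smallP; exists I, V; split => // v.
by rewrite ffunE oppr_eq0; exact: sub.
Qed.

Lemma smallB n1 n2 a b : small n1 a -> small n2 b -> small (n1 + n2) (a - b).
Proof. by move=> sa sb; apply: smallD => //; exact: smallN. Qed.

Lemma small_lift c b : small 1 (lift_word c b).
Proof.
apply/smallP; exists [set c], set0; rewrite cards1 cards0; split => // v.
rewrite !ffunE; case: ifP => [eqv _|_]; rewrite ?eqxx // !inE /=.
by apply/existsP; exists c; rewrite inE eqxx eqv.
Qed.

Lemma small_point (v : var) (y : F) : small 1 [ffun u => if u == v then y else 0].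
Proof.
apply/smallP; exists set0, [set v]; rewrite cards1 cards0; split => // u.
by rewrite ffunE inE; case: ifP => //; rewrite eqxx.
Qed.

Lemma quad_evalD p p' i : @quad_eval F (p + p') i = quad_eval p i + quad_eval p' i.
Proof. by rewrite /quad_eval /=; ring. Qed.

Lemma dual_wordP (b : {ffun F -> F}) :
  reflect (forall p, \sum_i b i * quad_eval p i = 0) (dual_word b).
Proof.
by apply: (iffP forallP) => h p; apply/eqP.
Qed.

Lemma dual_word0 : dual_word 0.
Proof. by apply/dual_wordP => p; rewrite big1 // => i _; rewrite ffunE mul0r. Qed.

Lemma dual_wordD b b' : dual_word b -> dual_word b' -> dual_word (b + b').
Proof.
move=> /dual_wordP h /dual_wordP h'; apply/dual_wordP => p.
under eq_bigr do rewrite ffunE mulrDl.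
by rewrite big_split /= h h' addr0.
Qed.

Lemma dual_wordN b : dual_word b -> dual_word (- b).
Proof.
move=> /dual_wordP h; apply/dual_wordP => p.
under eq_bigr do rewrite ffunE mulNr.
by rewrite sumrN h oppr0.
Qed.

(* Otherwise some quadratic polynomial vanishes on all but one point of the
   support. *)
Lemma dual_word_weight (b : {ffun F -> F}) :
  dual_word b -> b != 0 -> (4 <= #|[set i | b i != 0%R]|)%N.
Proof.
move=> /dual_wordP dw nz; rewrite leqNgt; apply/negP => lt4.
have [i bi] : exists i, b i != 0.
  apply/existsP; apply: contraNT nz; rewrite negb_exists => /forallP a0.
  by apply/eqP/ffunP => i; rewrite ffunE; apply/eqP; rewrite -[_ == _]negbK.
(* As default of [nth], a point other than [i] keeps both roots away from [i] even if the support
   has fewer than two other points. *)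
have [z zi] : exists z, z != i.
  by exists (if i == 0 then 1 else 0); case: (eqVneq i 0) => [->|]; rewrite ?oner_eq0 // eq_sym.
pose A := [set i | b i != 0] :\ i.
have A2 : (#|A| <= 2)%N.
  by move: lt4; rewrite (cardsD1 i) inE bi add1n !ltnS.
pose j := nth z (enum A) 0; pose k := nth z (enum A) 1.
have nthA x : nth z (enum A) x != i.
  have [lt|ge] := ltnP x (size (enum A)); last by rewrite nth_default.
  by have := mem_nth z lt; rewrite mem_enum !inE => /andP[].
have Ajk x : x \in A -> (x == j) || (x == k).
  rewrite -mem_enum => xA; have := nth_index z xA.
  have : (index x (enum A) < 2)%N.
    by apply: leq_trans A2; rewrite cardE index_mem.
  by rewrite /j /k; case: (index x (enum A)) => [|[|//]] _ <-; rewrite eqxx ?orbT.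
have evE x : quad_eval (j * k, - (j + k), 1) x = (x - j) * (x - k).
  by rewrite /quad_eval /=; ring.
have := dw (j * k, - (j + k), 1); rewrite (bigD1 i) //= big1 => [|x xi].
  rewrite addr0 evE => /eqP; rewrite !mulf_eq0 (negbTE bi) !subr_eq0 /=.
  by rewrite [i == j]eq_sym [i == k]eq_sym (negbTE (nthA 0%N)) (negbTE (nthA 1%N)).
have [->|bx] := eqVneq (b x) 0; first by rewrite mul0r.
rewrite evE; have : x \in A by rewrite !inE xi bx.
by move/Ajk => /orP[]/eqP ->; rewrite subrr ?mul0r ?mulr0.
Qed.

Lemma supp_familyD B B' : supp_family (B + B') \subset supp_family B :|: supp_family B'.
Proof.
apply/subsetP => c; rewrite !inE ffunE; apply: contraR.
by rewrite negb_or !negbK => /andP[/eqP -> /eqP ->]; rewrite addr0.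
Qed.

Lemma lift_wordD c b b' : lift_word c (b + b') = lift_word c b + lift_word c b'.
Proof. by apply/ffunP => v; rewrite !ffunE; case: ifP; rewrite ?ffunE ?addr0. Qed.

Lemma lift_wordN c b : lift_word c (- b) = - lift_word c b.
Proof. by apply/ffunP => v; rewrite !ffunE; case: ifP; rewrite ?ffunE ?oppr0. Qed.

Lemma derivesD s s' B B' a a' : derives s B a -> derives s' B' a' ->
  derives (s + s') (B + B') (a + a').
Proof.
move=> /and3P[/forallP d /eqP <- le] /and3P[/forallP d' /eqP <- le'].
apply/and3P; split.
- by apply/forallP => c; rewrite ffunE dual_wordD.
- by rewrite -big_split /=; apply/eqP/eq_bigr => c _; rewrite ffunE lift_wordD.
- apply: leq_trans (subset_leq_card (supp_familyD _ _)) _.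
  by rewrite (leq_trans (leq_card_setU _ _)) // leq_add.
Qed.

Lemma derivesN s B a : derives s B a -> derives s (- B) (- a).
Proof.
move=> /and3P[/forallP d /eqP <- le]; apply/and3P; split.
- by apply/forallP => c; rewrite ffunE dual_wordN.
- by rewrite -sumrN; apply/eqP/eq_bigr => c _; rewrite ffunE lift_wordN.
- rewrite (_ : supp_family _ = supp_family B) //.
  by apply/setP => c; rewrite !inE ffunE oppr_eq0.
Qed.

Lemma family_valueD B B' : family_value (B + B') = family_value B + family_value B'.
Proof.
rewrite -big_split; apply: eq_bigr => c _; rewrite -big_split; apply: eq_bigr => i _ /=.
by rewrite !ffunE mulrDl.
Qed.

Lemma family_valueN B : family_value (- B) = - family_value B.
Proof.
rewrite -sumrN; apply: eq_bigr => c _; rewrite -sumrN; apply: eq_bigr => i _ /=.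
by rewrite !ffunE mulNr.
Qed.

Variable S : nat.
Hypothesis g_expanding : expanding g S.

(* Every variable touched by a dual word outside [I] must cancel, so it is
   either in [V] or covered twice; as the words have weight at least 4 this
   contradicts expansion unless there are few of them. *)
Lemma derives_small s n B a : derives s B a -> small n a -> (s + n <= S)%N ->
  (#|supp_family B| <= 16 * n)%N.
Proof.
move=> /and3P[/forallP dualB /eqP aE sB] /smallP[I [V [leI sub]]] leS.
pose T := supp_family B; pose U := T :|: I; pose D := T :\: I.
have cU : (#|U| <= S)%N.
  rewrite (leq_trans (leq_card_setU _ _)) // (leq_trans _ leS) //.
  by rewrite leq_add // (leq_trans _ leI) // leq_addr.
pose cov (v : var) := #|[set c in U | scope c v.1 == v.2]|.
pose tou (v : var) := #|[set c in D | (scope c v.1 == v.2) && (B c v.1 != 0)]|.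
(* A variable covered at least twice satisfies cov <= 2 (cov - 1). If only [c] covers it, the entry
   of its word survives in [a]; as [c] lies outside [I], the variable must lie in [V]. *)
have touE v : (tou v <= 2 * (cov v - (v \in nbr U)) + (v \in V))%N.
  have [->//|] := posnP (tou v).
  move=> /card_gt0P[c]; rewrite inE => /and3P[cD cv Bcv].
  have cDT : (c \notin I) && (c \in T) by move: cD; rewrite inE.
  have cU' : c \in U by case/andP: cDT => _ cT; rewrite inE cT.
  have vU : v \in nbr U by rewrite inE; apply/existsP; exists c; rewrite cU' cv.
  have tc : (tou v <= cov v)%N.
    apply/subset_leq_card/subsetP => c'; rewrite !inE => /and3P[/andP[_ ->] -> _] //.
  have [cov1|cov2] := leqP (cov v) 1; last by rewrite vU; lia.
  have only c' : c' \in U -> scope c' v.1 == v.2 -> c' = c.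
    move=> c'U c'v; apply: (card_le1_eqP cov1).
      by rewrite in_set cU' cv.
    by rewrite in_set c'U c'v.
  have av : a v = B c v.1.
    rewrite -aE sum_ffunE (bigD1 c) //= big1 ?addr0 => [|c' c'c].
      by rewrite ffunE cv.
    rewrite ffunE; case: ifP => // c'v.
    have [c'U|] := boolP (c' \in U); first by rewrite (only c') ?eqxx in c'c.
    by rewrite !inE negb_or negbK => /andP[/eqP -> _]; rewrite ffunE.
  have /orP[->|] := sub v (etrans (congr1 (fun z => z != 0) av) Bcv).
    by rewrite vU; lia.
  rewrite inE => /existsP[c' /andP[c'I c'v]].
  have := only c' _ c'v; rewrite inE c'I orbT => /(_ isT) eqc.
  by move: cDT; rewrite -eqc c'I.
have sumtou : (4 * #|D| <= \sum_v tou v)%N.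
  have -> : (\sum_v tou v = \sum_(c in D) #|[set i | B c i != 0%R]|)%N.
    rewrite (eq_bigr (fun v => \sum_(c in D)
        ((scope c v.1 == v.2) && (B c v.1 != 0%R) : nat))%N); last first.
      move=> v _; rewrite /tou -sum1_card big_mkcond [RHS]big_mkcond.
      by apply: eq_bigr => c _; rewrite inE; case: (c \in D) => //=; case: (_ && _).
    rewrite exchange_big /=; apply: eq_bigr => c cD.
    rewrite -(pair_bigA _ (fun i w => ((scope c i == w) && (B c i != 0) : nat))) /=.
    rewrite -sum1_card [RHS]big_mkcond; apply: eq_bigr => i _.
    rewrite (bigD1 (scope c i)) //= eqxx big1 ?addn0 /= => [|w wc].
      by rewrite inE; case: (_ != _).
    by rewrite eq_sym (negbTE wc).
  rewrite mulnC -sum_nat_const; apply: leq_sum => c.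
  by rewrite !inE => /andP[_ Bc]; apply: dual_word_weight.
have sumcov : (\sum_v cov v = #|F| * #|U|)%N.
  rewrite (eq_bigr (fun v => \sum_(c in U) (scope c v.1 == v.2 : nat))%N); last first.
    move=> v _; rewrite /cov -sum1_card big_mkcond [RHS]big_mkcond.
    by apply: eq_bigr => c _; rewrite inE; case: (c \in U) => //=; case: (_ == _).
  rewrite exchange_big /= mulnC -sum_nat_const; apply: eq_bigr => c _.
  rewrite -(pair_bigA _ (fun i w => (scope c i == w : nat))) /= -sum1_card.
  apply: eq_bigr => i _; rewrite (bigD1 (scope c i)) //= eqxx big1 ?addn0 // => w wc.
  by rewrite eq_sym (negbTE wc).
have covn v : ((v \in nbr U) <= cov v)%N.
  rewrite inE; case: existsP => // -[c /andP[cU' cv]].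
  by apply/card_gt0P; exists c; rewrite inE cU' cv.
have sumV (X : {set var}) : (\sum_v (v \in X) = #|X|)%N.
  by rewrite -sum1_card [RHS]big_mkcond; apply: eq_bigr => v _; case: (v \in X).
(* Expansion turns this into 4|D| <= (15/4)(|D| + |I|) + |V|, hence |D| <= 15|I| + 4|V| and |T| <=
   16 n. *)
have key : (4 * #|D| <= 2 * (#|F| * #|U| - #|nbr U|) + #|V|)%N.
  rewrite (leq_trans sumtou) // -sumcov -!sumV -sumnB // big_distrr -big_split /=.
  exact: leq_sum.
have Ucard : (#|U| <= #|D| + #|I|)%N.
  rewrite (_ : U = D :|: I) ?leq_card_setU //.
  by apply/setP => c; rewrite !inE; case: (c \in I); rewrite ?orbT ?orbF.
have Tcard : (#|T| <= #|D| + #|I|)%N.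
  by rewrite (leq_trans _ Ucard) // subset_leq_card // subsetUl.
have := g_expanding cU; move: key Ucard Tcard leI; rewrite -/T.
move: (#|F| * #|U|)%N #|nbr U| #|U| #|T| #|D| #|I| #|V| => a1 a2 a3 a4 a5 a6 a7.
lia.
Qed.

(** The difference of two derivations derives 0, which is small at level 0, so it consists of no
    constraint at all. *)
Lemma derives_uniq s B B' a : (2 * s <= S)%N ->
  derives s B a -> derives s B' a -> B = B'.
Proof.
move=> leS d d'; have := derivesD d (derivesN d'); rewrite subrr => dd.
have := derives_small dd (small0 0); rewrite addn0 addnn -mul2n => /(_ leS).
rewrite muln0 leqn0 cards_eq0 => /eqP e0; apply/eqP; rewrite -subr_eq0.
apply/eqP/ffunP => c; have /setP/(_ c) := e0; rewrite !inE => /negbT.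
by rewrite negbK => /eqP ->; rewrite ffunE.
Qed.

End Derivations.

(** * The pseudo-expectation *)

Section PseudoExpectation.
Variables (R : realType) (F : finFieldType) (psi : F -> R).
Hypothesis psiD : forall x y, psi (x + y) = psi x * psi y.
Hypothesis psi_sq : forall x, psi x ^+ 2 = 1.
Hypothesis psi_sum : \sum_x psi x = 0.
Variables (W : finType) (m : nat) (g : game F W m) (rho : nat).
Hypothesis g_expanding : expanding g (33 * rho).
Local Notation var := (F * W)%type.
Local Notation chr := {ffun var -> F}.
Local Notation family := {ffun 'I_m -> {ffun F -> F}}.
Local Notation derives := (derives g).
Local Notation small := (small g).

Definition chi (a x : chr) : R := psi (\sum_v a v * x v).

Lemma chiD a b x : chi (a + b) x = chi a x * chi b x.
Proof.
rewrite /chi -psiD -big_split; congr psi; apply: eq_bigr => v _.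
by rewrite ffunE mulrDl.
Qed.

Lemma chiN a x : chi (- a) x = chi a x.
Proof.
rewrite /chi -(psiN psiD psi_sq) -sumrN; congr psi; apply: eq_bigr => v _.
by rewrite ffunE mulNr opprK.
Qed.

Lemma chi0 x : chi 0 x = 1.
Proof.
rewrite /chi big1 ?(psi0 psiD psi_sq) // => v _; by rewrite ffunE mul0r.
Qed.

(** The pseudo-moment of the character [a]. The threshold 16 * rho is the size to which
    [derives_small] shrinks a derivation of a character small at level [rho]; by uniqueness the
    picked derivation is immaterial. *)
Definition pchar (a : chr) : R :=
  if [pick B | derives (16 * rho) B a] is Some B then psi (family_value g B) else 0.

Lemma pchar_derives B a :
  derives (16 * rho) B a -> pchar a = psi (family_value g B).
Proof.
move=> d; rewrite /pchar; case: pickP => [B' d'|/(_ B)]; last by rewrite d.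
by rewrite (derives_uniq g_expanding _ d d') //; lia.
Qed.

Lemma pchar_neq0 a : pchar a != 0 -> exists B, derives (16 * rho) B a.
Proof. by rewrite /pchar; case: pickP => [B d _|_]; [exists B|rewrite eqxx]. Qed.

(* A derivation of twice the allowed size of a small character shrinks back
   below the threshold; this is what makes derivability transitive. *)
Lemma pchar_derives_long s B a : (s <= 32 * rho)%N -> derives s B a ->
  small rho a -> pchar a = psi (family_value g B).
Proof.
move=> le d sm; apply: pchar_derives.
have h : (s + rho <= 33 * rho)%N by lia.
have := derives_small g_expanding d sm h.
by case/and3P: d => d1 d2 _ d3; apply/and3P.
Qed.

Lemma derives0 s : derives s 0 0.
Proof.
apply/and3P; split.
- by apply/forallP => c; rewrite ffunE dual_word0.
- apply/eqP/big1 => c _; apply/ffunP => v; rewrite !ffunE; by case: ifP; rewrite ?ffunE.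
- rewrite (_ : supp_family 0 = set0) ?cards0 //.
  by apply/setP => c; rewrite !inE ffunE eqxx.
Qed.

Lemma pchar0 : pchar 0 = 1.
Proof.
rewrite (pchar_derives (derives0 _)) /family_value.
rewrite big1 ?(psi0 psiD psi_sq) // => c _; rewrite big1 // => i _.
by rewrite !ffunE mul0r.
Qed.

Lemma pcharN a : pchar (- a) = pchar a.
Proof.
have N b : pchar b != 0 -> pchar (- b) = pchar b.
  move=> /pchar_neq0[B d]; rewrite (pchar_derives d) (pchar_derives (derivesN d)).
  by rewrite family_valueN (psiN psiD psi_sq).
have [a0|] := eqVneq (pchar a) 0; last exact: N.
have [->//|nz] := eqVneq (pchar (- a)) 0.
by have := N _ nz; rewrite opprK a0 => z; rewrite -z eqxx in nz.
Qed.

Lemma pcharD a b : small rho (a + b) -> pchar a != 0 -> pchar b != 0 ->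
  pchar (a + b) = pchar a * pchar b.
Proof.
move=> sm /pchar_neq0[B d] /pchar_neq0[B' d'].
rewrite (pchar_derives d) (pchar_derives d') -psiD -family_valueD.
by apply: (pchar_derives_long _ (derivesD d d') sm); lia.
Qed.

Hypothesis rho_gt0 : (0 < rho)%N.

Definition word_value (c : 'I_m) (b : {ffun F -> F}) : F := \sum_i b i * shift g c i.

Lemma pchar_lift c b : dual_word b -> pchar (lift_word g c b) = psi (word_value c b).
Proof.
move=> db; pose B : family := [ffun c' => if c' == c then b else 0].
have d : derives (16 * rho) B (lift_word g c b).
  apply/and3P; split.
  - by apply/forallP => c'; rewrite ffunE; case: ifP; rewrite ?dual_word0.
  - rewrite (bigD1 c) //= big1 => [|c' ne]; first by rewrite addr0 ffunE eqxx.
    by apply/ffunP => v; rewrite !ffunE (negbTE ne); case: ifP; rewrite ?ffunE.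
  - apply: (leq_trans (n := #|[set c]|)); last by rewrite cards1; lia.
    apply/subset_leq_card/subsetP => c'; rewrite !inE ffunE.
    by case: ifP => //; rewrite eqxx.
rewrite (pchar_derives d) /family_value (bigD1 c) //= [X in _ + X]big1 ?addr0 => [|c' ne].
  by congr psi; apply: eq_bigr => i _; rewrite ffunE eqxx.
by rewrite big1 // => i _; rewrite ffunE (negbTE ne) ffunE mul0r.
Qed.

(** If the sum is derivable, so is [a], by subtracting the lift; hence both sides vanish together.
    The level rho - 1 leaves room for the lift. *)
Lemma pchar_lift_add c b a : dual_word b -> small rho.-1 a ->
  pchar (lift_word g c b + a) = psi (word_value c b) * pchar a.
Proof.
move=> db sa.
have sm : small rho (lift_word g c b + a).
  by rewrite -(prednK rho_gt0) -add1n; apply: smallD => //; exact: small_lift.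
have nzl : pchar (lift_word g c b) != 0 by rewrite pchar_lift // (psi_neq0 psi_sq).
have [a0|nza] := eqVneq (pchar a) 0; last by rewrite pcharD // pchar_lift.
rewrite a0 mulr0; apply/eqP/negPn/negP => nz.
have sa' : small rho a by apply: small_leq sa; exact: leq_pred.
have := @pcharD (- lift_word g c b) (lift_word g c b + a).
rewrite addKr pcharN a0 => /(_ sa' nzl nz) /esym/eqP.
by rewrite mulf_eq0 (negbTE nzl) (negbTE nz).
Qed.

(** Fourier inversion: the function on assignments with coefficients [pchar]. It makes the
    pseudo-expectation an actual linear functional on functions; nonnegativity is claimed only
    against squares of low degree. *)
Definition density (x : chr) : R := (#|{: chr}|%:R)^-1 * \sum_a pchar a * chi a x.

Definition pE (G : chr -> R) : R := \sum_x density x * G x.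

Lemma eq_pE G H : G =1 H -> pE G = pE H.
Proof. by move=> e; apply: eq_bigr => x _; rewrite e. Qed.

Lemma pE_sum (I : finType) (P : pred I) (G : I -> chr -> R) :
  pE (fun x => \sum_(i | P i) G i x) = \sum_(i | P i) pE (G i).
Proof.
rewrite /pE exchange_big /=; apply: eq_bigr => x _; by rewrite mulr_sumr.
Qed.

Lemma pEZ k G : pE (fun x => k * G x) = k * pE G.
Proof. by rewrite /pE mulr_sumr; apply: eq_bigr => x _; rewrite mulrCA. Qed.

Lemma pEB G H : pE (fun x => G x - H x) = pE G - pE H.
Proof. by rewrite /pE -sumrB; apply: eq_bigr => x _; rewrite mulrBr. Qed.

Lemma pE_chi a : pE (chi a) = pchar a.
Proof.
rewrite /pE /density.
have card_ne : (#|{: chr}|%:R : R) != 0.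
  by rewrite pnatr_eq0 -lt0n; apply/card_gt0P; exists 0.
under eq_bigr do rewrite -mulrA mulr_suml.
rewrite -mulr_sumr exchange_big /=.
have ort b : \sum_x pchar b * chi b x * chi a x = pchar b * (#|{: chr}| * (b == a))%:R.
  under eq_bigr do rewrite -mulrA -[chi a _]chiN -chiD.
  by rewrite -mulr_sumr (sum_psi_ffun psiD psi_sq psi_sum) subr_eq0 card_ffun.
under eq_bigr do rewrite ort.
rewrite (bigD1 a) //= eqxx muln1 big1 ?addr0 => [|b /negbTE ->].
  by rewrite mulrCA mulVf ?mulr1.
by rewrite muln0 mulr0.
Qed.

(** * Functions of bounded degree and positivity on their squares *)

Definition spanned (n : nat) (G : chr -> R) : Prop :=
  exists f : chr -> R, (forall a, f a != 0 -> small n a) /\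
    G =1 (fun x => \sum_a f a * chi a x).

Lemma spanned_eq n G H : G =1 H -> spanned n G -> spanned n H.
Proof. by move=> e [f [sf fE]]; exists f; split => // x; rewrite -e fE. Qed.

Lemma spanned_leq n1 n2 G : (n1 <= n2)%N -> spanned n1 G -> spanned n2 G.
Proof.
move=> le [f [sf fE]]; exists f; split => // a /sf; exact: small_leq.
Qed.

Lemma spanned_chi n a : small n a -> spanned n (chi a).
Proof.
move=> sa; exists (fun b => (b == a)%:R); split.
  by move=> b; case: (eqVneq b a) => [->//|_]; rewrite eqxx.
move=> x; rewrite (bigD1 a) //= eqxx mul1r big1 ?addr0 // => b /negbTE ->.
by rewrite mul0r.
Qed.

Lemma spannedZ n k G : spanned n G -> spanned n (fun x => k * G x).
Proof.
case=> f [sf fE]; exists (fun a => k * f a); split.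
  by move=> a; rewrite mulf_eq0 negb_or => /andP[_ /sf].
by move=> x; rewrite fE mulr_sumr; apply: eq_bigr => a _; rewrite mulrA.
Qed.

Lemma spannedD n G H : spanned n G -> spanned n H -> spanned n (fun x => G x + H x).
Proof.
move=> [f [sf fE]] [h [sh hE]]; exists (fun a => f a + h a); split.
  move=> a; have [->|/sf//] := eqVneq (f a) 0; rewrite add0r; exact: sh.
by move=> x; rewrite fE hE -big_split; apply: eq_bigr => a _; rewrite mulrDl.
Qed.

Lemma spanned0 n : spanned n (fun=> 0).
Proof.
exists (fun=> 0); split=> [a|x]; first by rewrite eqxx.
by rewrite big1 // => a _; rewrite mul0r.
Qed.

Lemma spanned1 n : spanned n (fun=> 1).
Proof.
by apply: (spanned_eq (G := chi 0)) => [x|]; [exact: chi0|apply: spanned_chi; exact: small0].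
Qed.

Lemma spanned_sum (I : finType) (P : pred I) n (G : I -> chr -> R) :
  (forall i, P i -> spanned n (G i)) -> spanned n (fun x => \sum_(i | P i) G i x).
Proof.
move=> sG; elim: (index_enum I) => [|i s IH].
  by apply: spanned_eq (spanned0 n) => x; rewrite big_nil.
have [Pi|nPi] := boolP (P i).
  by apply: spanned_eq (spannedD (sG i Pi) IH) => x; rewrite big_cons Pi.
by apply: spanned_eq IH => x; rewrite big_cons (negbTE nPi).
Qed.

Lemma spannedM n1 n2 G H : spanned n1 G -> spanned n2 H ->
  spanned (n1 + n2) (fun x => G x * H x).
Proof.
move=> [f [sf fE]] [h [sh hE]].
apply: (spanned_eq (G := fun x => \sum_(a | f a != 0) \sum_(b | h b != 0)
    (f a * h b) * chi (a + b) x)).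
  move=> x; rewrite fE hE mulr_suml big_mkcond; apply: eq_bigr => a _.
  case: eqVneq => [->|_] /=; first by rewrite !mul0r.
  rewrite mulr_sumr big_mkcond; apply: eq_bigr => b _.
  case: eqVneq => [->|_] /=; first by rewrite mul0r mulr0.
  by rewrite chiD; ring.
apply: spanned_sum => a fa; apply: spanned_sum => b hb; apply/spannedZ/spanned_chi.
by apply: smallD; [exact: sf|exact: sh].
Qed.

(** In the character basis this is the quadratic form of the kernel [pchar (a - b)]. As 2 n <= rho,
    all differences are small, so the kernel is multiplicative and [psd_kernel] applies. *)
Lemma pE_sq_ge0 n G : (2 * n <= rho)%N -> spanned n G -> 0 <= pE (fun x => G x ^+ 2).
Proof.
move=> le [f [sf fE]].
have -> : pE (fun x => G x ^+ 2) =
    \sum_(a | small n a) \sum_(b | small n b) f a * f b * pchar (a - b).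
  transitivity (pE (fun x => \sum_(a | small n a) \sum_(b | small n b)
      (f a * f b) * chi (a - b) x)).
    apply: eq_pE => x; rewrite fE expr2 mulr_suml [RHS]big_mkcond; apply: eq_bigr => a _.
    case: ifP => [_|/negbT na]; last first.
      have -> : f a = 0 by apply/eqP; apply: contraNT na; exact: sf.
      by rewrite !mul0r.
    rewrite mulr_sumr [RHS]big_mkcond; apply: eq_bigr => b _.
    case: ifP => [_|/negbT nb]; last first.
      have -> : f b = 0 by apply/eqP; apply: contraNT nb; exact: sf.
      by rewrite mul0r mulr0.
    by rewrite chiD chiN; ring.
  rewrite pE_sum; apply: eq_bigr => a _; rewrite pE_sum; apply: eq_bigr => b _.
  by rewrite pEZ pE_chi.
apply: (@psd_kernel _ _ (small n) (fun a b => pchar (a - b))) => [a _|a b|a b c sa sb sc nab nbc].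
- by rewrite subrr pchar0.
- by rewrite -pcharN opprB.
- have e : a - c = (a - b) + (b - c) by rewrite addrA subrK.
  rewrite e pcharD // -e; apply: small_leq le _; rewrite mul2n -addnn.
  exact: smallB.
Qed.

(** * Events of constraints and variables *)

Definition con_event (c : 'I_m) (p : F * F * F) (x : chr) : R :=
  [forall i, x (i, scope g c i) == quad_eval p i + shift g c i]%:R.

Definition var_event (v : var) (y : F) (x : chr) : R := (x v == y)%:R.

Lemma psi_delta (y : F) : (y == 0)%:R = (#|F|%:R)^-1 * \sum_a psi (a * y).
Proof.
have nz : (#|F|%:R : R) != 0 by rewrite pnatr_eq0 -lt0n; apply/card_gt0P; exists 0.
under eq_bigr do rewrite mulrC.
by rewrite (sum_psi_mul psiD psi_sq psi_sum) natrM mulrA mulVf // mul1r.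
Qed.

Lemma spanned_var_event v y : spanned 1 (var_event v y).
Proof.
apply: (spanned_eq (G := fun x => \sum_(a : F) ((#|F|%:R)^-1 * psi (a * y)) *
    chi [ffun u => if u == v then a else 0] x)).
  move=> x; rewrite /var_event -subr_eq0 psi_delta mulr_sumr; apply: eq_bigr => a _.
  have -> : chi [ffun u => if u == v then a else 0] x = psi (a * x v).
    rewrite /chi (bigD1 v) //= ffunE eqxx big1 ?addr0 // => u /negbTE ne.
    by rewrite ffunE ne mul0r.
  by rewrite mulrBr (psiB psiD psi_sq); ring.
by apply: spanned_sum => a _; apply/spannedZ/spanned_chi/small_point.
Qed.

Lemma chi_lift c b x : chi (lift_word g c b) x = psi (\sum_i b i * x (i, scope g c i)).
Proof.
rewrite /chi; congr psi.
transitivity (\sum_(v : var) lift_word g c b (v.1, v.2) * x (v.1, v.2)).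
  by apply: eq_bigr => -[].
rewrite -(pair_bigA _ (fun i w => lift_word g c b (i, w) * x (i, w))) /=.
apply: eq_bigr => i _; rewrite (bigD1 (scope g c i)) //= ffunE eqxx big1 ?addr0 //.
by move=> w ne; rewrite ffunE /= eq_sym (negbTE ne) mul0r.
Qed.

Definition word_pairing (p : F * F * F) (b : {ffun F -> F}) : F :=
  \sum_i b i * quad_eval p i.

(** Expanding the delta function at each position yields one term per word [b]. Every character that
    occurs is a lift, so the event has degree 1 although it fixes |F| variables. *)
Lemma con_eventE c p x : con_event c p x = \sum_(b : {ffun F -> F})
  ((#|F|%:R)^-1 ^+ #|F| * psi (word_value c b) * psi (word_pairing p b)) *
  chi (lift_word g c b) x.
Proof.
have -> : con_event c p x =
    \prod_i (x (i, scope g c i) - (quad_eval p i + shift g c i) == 0)%:R.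
  rewrite /con_event; case: forallP => [h|nh].
    by rewrite big1 // => i _; rewrite subr_eq0 h.
  suff [i ne] : exists i, x (i, scope g c i) != quad_eval p i + shift g c i.
    by rewrite (bigD1 i) //= subr_eq0 (negbTE ne) mul0r.
  by apply/existsP; rewrite -negb_forall; apply/negP => /forallP.
under eq_bigr do rewrite psi_delta.
rewrite big_split /= prodr_const bigA_distr_bigA mulr_sumr; apply: eq_bigr => b _.
rewrite -!mulrA; congr (_ * _); rewrite chi_lift -(psi_bigsum psiD psi_sq).
have -> : \sum_i b i * (x (i, scope g c i) - (quad_eval p i + shift g c i)) =
    \sum_i b i * x (i, scope g c i) - word_pairing p b - word_value c b.
  by rewrite -!sumrB; apply: eq_bigr => i _; ring.
by rewrite !(psiB psiD psi_sq); ring.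
Qed.

Lemma spanned_con_event c p : spanned 1 (con_event c p).
Proof.
apply: (spanned_eq (G := fun x => _)); first by move=> x; rewrite con_eventE.
by apply: spanned_sum => b _; apply/spannedZ/spanned_chi/small_lift.
Qed.

(** If [b] pairs nontrivially with some codeword, a multiple of it pairs to a [y] with psi y
    different from 1; translating the sum by that multiple scales it by psi y, so it is 0. *)
Lemma sum_psi_pairing b :
  \sum_p psi (word_pairing p b) = (#|F| ^ 3 * dual_word b)%:R.
Proof.
have [/dual_wordP db|] := boolP (dual_word b).
  under eq_bigr do rewrite /word_pairing db (psi0 psiD psi_sq).
  by rewrite sumr_const muln1 !card_prod expnSr mulnn.
rewrite negb_forall => /existsP[p0 nz]; rewrite muln0.
have [y ny] : exists y, psi y != 1.
  apply/existsP; rewrite -[X in is_true X]negbK negb_exists; apply/negP => /forallP h.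
  have := psi_sum; under eq_bigr => x _ do rewrite (eqP (negbNE (h x))).
  by rewrite sumr_const => /eqP; rewrite pnatr_eq0 -[_ == _]negbK -lt0n;
    move/negP; apply; apply/card_gt0P; exists 0.
pose l := y / word_pairing p0 b.
pose q : F * F * F := (l * p0.1.1, l * p0.1.2, l * p0.2).
have qE p : word_pairing (p + q) b = word_pairing p b + y.
  rewrite /word_pairing; under eq_bigr do rewrite quad_evalD mulrDr.
  rewrite big_split /=; congr (_ + _).
  rewrite -[RHS](divfK nz) -/l mulr_sumr; apply: eq_bigr => i _.
  by rewrite /quad_eval /=; ring.
set s := \sum_p _; have : s = s * psi y.
  rewrite {1}/s (reindex_inj (addIr q)) /= mulr_suml.
  by apply: eq_bigr => p _; rewrite qE psiD.
move/eqP; rewrite -subr_eq0 -{1}[s]mulr1 -mulrBr mulf_eq0 subr_eq0 [1 == _]eq_sym (negbTE ny).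
by rewrite orbF => /eqP.
Qed.

Hypothesis card_gt2 : (2 < #|F|)%N.

Lemma quad_eval_inj0 p : (forall i, quad_eval p i = 0 :> F) -> p = 0.
Proof.
move=> h; have [x /andP[x0 x1]] : exists x : F, (x != 0) && (x != 1).
  apply/existsP; rewrite -[X in is_true X]negbK negb_exists; apply/negP => /forallP h01.
  have : (#|F| <= #|[set 0%R; 1%R : F]|)%N.
    apply: subset_leq_card; apply/subsetP => x _.
    by rewrite !inE; have := h01 x; rewrite negb_and !negbK.
  by rewrite cards2 leqNgt (leq_trans _ card_gt2) //; case: (_ != _).
case: p h => [[a b] c] h.
have a0 : a = 0 by have := h 0; rewrite /quad_eval /= mulr0 expr0n mulr0 !addr0.
have bc : b = - c.
  apply/eqP; rewrite -addr_eq0; have := h 1.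
  by rewrite /quad_eval /= a0 mulr1 expr1n mulr1 add0r => ->.
have c0 : c = 0.
  apply/eqP; have := h x; rewrite /quad_eval /= a0 bc.
  rewrite (_ : _ + _ = c * (x * (x - 1))); last by ring.
  by move/eqP; rewrite !mulf_eq0 subr_eq0 (negbTE x0) (negbTE x1) !orbF.
by rewrite a0 bc c0 oppr0.
Qed.

Lemma sum_con_eventE c x : \sum_p con_event c p x =
  \sum_(b | dual_word b) ((#|F|%:R)^-1 ^+ #|F| * (#|F| ^ 3)%:R * psi (word_value c b)) *
     chi (lift_word g c b) x.
Proof.
under eq_bigr do rewrite con_eventE.
rewrite exchange_big /= [RHS]big_mkcond; apply: eq_bigr => b _.
rewrite -mulr_suml -mulr_sumr sum_psi_pairing.
by case: (dual_word b); rewrite ?muln1 ?muln0 ?mulr0 ?mul0r //; ring.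
Qed.

(** This counts the dual words, by evaluating the expansion at an assignment that satisfies the
    constraint with the codeword 0 and no other. *)
Lemma dual_word_mass (c : 'I_m) :
  \sum_(b : {ffun F -> F} | dual_word b) ((#|F|%:R)^-1 ^+ #|F| * (#|F| ^ 3)%:R) = 1 :> R.
Proof.
pose x : chr := [ffun v => shift g c v.1].
have evx p : con_event c p x = (p == 0)%:R.
  rewrite /con_event; congr (nat_of_bool _)%:R; apply/forallP/eqP => [h|-> i].
    apply: quad_eval_inj0 => i; have := h i.
    by rewrite ffunE /= -{1}[shift g c i]add0r (inj_eq (addIr _)) => /eqP.
  by rewrite ffunE /quad_eval /= !mul0r !add0r.
transitivity (\sum_p con_event c p x); last first.
  rewrite (bigD1 (0 : F * F * F)) //= evx eqxx big1 ?addr0 // => p /negbTE ne.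
  by rewrite evx ne.
rewrite sum_con_eventE; apply: eq_bigr => b _; rewrite chi_lift.
have -> : \sum_i b i * x (i, scope g c i) = word_value c b.
  by apply: eq_bigr => i _; rewrite ffunE.
by rewrite -mulrA -expr2 psi_sq mulr1.
Qed.

(** Only dual words survive the sum over codewords. The sign of each in the expansion equals the one
    that [pchar] gives its lift, so the signs cancel and the remaining weights add up to 1. *)
Lemma pE_con c G : spanned rho.-1 G -> pE (fun x => (\sum_p con_event c p x) * G x) = pE G.
Proof.
move=> [f [sf fE]].
have GE : pE G = \sum_a f a * pchar a.
  rewrite (eq_pE fE) pE_sum; apply: eq_bigr => a _; by rewrite pEZ pE_chi.
transitivity (pE (fun x => \sum_(b | dual_word b) \sum_a
   ((#|F|%:R)^-1 ^+ #|F| * (#|F| ^ 3)%:R * psi (word_value c b) * f a) *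
     chi (lift_word g c b + a) x)).
  apply: eq_pE => x; rewrite sum_con_eventE fE mulr_suml; apply: eq_bigr => b _.
  by rewrite mulr_sumr; apply: eq_bigr => a _; rewrite chiD; ring.
transitivity ((\sum_(b : {ffun F -> F} | dual_word b)
    ((#|F|%:R)^-1 ^+ #|F| * (#|F| ^ 3)%:R)) * pE G); last by rewrite (dual_word_mass c) mul1r.
rewrite pE_sum mulr_suml; apply: eq_bigr => b db.
rewrite pE_sum GE mulr_sumr; apply: eq_bigr => a _; rewrite pEZ pE_chi.
have [->|/sf sa] := eqVneq (f a) 0; first by rewrite !(mulr0, mul0r).
rewrite pchar_lift_add //; have := psi_sq (word_value c b); rewrite expr2 => e.
transitivity ((#|F|%:R)^-1 ^+ #|F| * (#|F| ^ 3)%:R *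
  (psi (word_value c b) * psi (word_value c b)) * (f a * pchar a)); first by ring.
by rewrite e mulr1.
Qed.

End PseudoExpectation.

(** * The network instance *)

Section Instance.
Variables (F : finFieldType) (W : finType) (m : nat) (g : game F W m).
Local Notation var := (F * W)%type.
Local Notation quad := (F * F * F)%type.
Local Notation scope := (scope g).
Local Notation shift := (shift g).

Definition vert : finType := ('I_m * F + 'I_m * quad + (var * F + var * F))%type.
Definition vSrc c j : vert := inl (inl (c, j)).
Definition vCon c p : vert := inl (inr (c, p)).
Definition vVar v y : vert := inr (inl (v, y)).
Definition vTgt v j : vert := inr (inr (v, j)).

(** The edges by type: source to codeword, codeword to label, label to target. Sums over edges
    become sums over this type through the bijection [edge_of]. *)
Definition kind : finType := ('I_m * F * quad + 'I_m * F * quad + var * F * F)%type.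
Definition kSrc c j p : kind := inl (inl (c, j, p)).
Definition kMid c i p : kind := inl (inr (c, i, p)).
Definition kTgt v j y : kind := inr (v, j, y).

Definition ends (k : kind) : vert * vert :=
  match k with
  | inl (inl (c, j, p)) => (vSrc c j, vCon c p)
  | inl (inr (c, i, p)) => (vCon c p, vVar (i, scope c i) (quad_eval p i + shift c i))
  | inr (v, j, y) => (vVar v y, vTgt v j)
  end.

Variables (V : finType) (io : vert -> V).
Hypothesis io_inj : injective io.

Definition ends_set (k : kind) : {set V} := [set io (ends k).1; io (ends k).2].
(** The injection [io] may leave isolated vertices, which pads the graph to any larger number of
    vertices. *)
Definition gap_graph : {set {set V}} := [set ends_set k | k : kind].
Local Notation edge := (edge gap_graph).

Lemma ends_set_in k : ends_set k \in gap_graph.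
Proof. exact: imset_f. Qed.

Definition edge_of (k : kind) : edge := exist _ (ends_set k) (ends_set_in k).

Definition gap_pairs : seq (V * V) :=
  [seq (io (vSrc t.1.1 t.2), io (vTgt (t.1.2, scope t.1.1 t.1.2) t.2))
     | t <- enum {: 'I_m * F * F}].

Lemma set2_eq (T : finType) (a b a' b' : T) : [set a; b] = [set a'; b'] ->
  (a = a' /\ b = b') \/ (a = b' /\ b = a').
Proof.
move=> /setP e.
have ha : (a == a') || (a == b') by rewrite -in_set2 -e set21.
have hb : (b == a') || (b == b') by rewrite -in_set2 -e set22.
have ha' : (a' == a) || (a' == b) by rewrite -in_set2 e set21.
have hb' : (b' == a) || (b' == b) by rewrite -in_set2 e set22.
case/orP: ha => /eqP ea; [left|right]; split => //; apply/eqP.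
  by case/orP: hb => // /eqP eb; case/orP: hb' => /eqP eb'; rewrite eb' ?ea ?eb.
by case/orP: hb => // /eqP eb; case/orP: ha' => /eqP ea'; rewrite ea' ?ea ?eb.
Qed.

Lemma ends_set_inj : injective ends_set.
Proof.
move=> k k' /set2_eq[] [/io_inj e1 /io_inj e2]; move: e1 e2;
case: k => [[[[c i] p]|[[c i] p]]|[[v j] y]];
case: k' => [[[[c' i'] p']|[[c' i'] p']]|[[v' j'] y']] //=.
- by case=> -> -> [->].
- by case=> -> -> [->].
- by case=> -> -> [->].
Qed.

Lemma edge_of_inj : injective edge_of.
Proof. by move=> k k' /(congr1 val)/ends_set_inj. Qed.

Lemma edge_ofP (e : edge) : exists k, e = edge_of k.
Proof.
case: e => s sE; have /imsetP[k _ sk] := sE; exists k.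
by apply: val_inj; rewrite /= sk.
Qed.

Lemma edge_of_bij : bijective edge_of.
Proof.
apply: inj_card_bij edge_of_inj _.
rewrite -(card_imset _ edge_of_inj) subset_leq_card //; apply/subsetP => e _.
by have [k ->] := edge_ofP e; rewrite imset_f.
Qed.

Lemma gap_simple : simple_graph gap_graph.
Proof.
move=> e /imsetP[k _ ->]; rewrite cards2.
by case: eqP => // /io_inj; case: k => [[[[c i] p]|[[c i] p]]|[[v j] y]].
Qed.

Definition gap_path (c : 'I_m) (i j : F) (p : quad) : seq V :=
  [:: io (vCon c p); io (vVar (i, scope c i) (quad_eval p i + shift c i));
      io (vTgt (i, scope c i) j)].

Lemma gap_pathP (e : rel V) c i j p :
  (forall k, e (io (ends k).1) (io (ends k).2)) ->
  short_path e 3 (io (vSrc c j)) (io (vTgt (i, scope c i) j)) (gap_path c i j p).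
Proof.
move=> eE; apply/and4P; split => //=.
  have := eE (kSrc c j p); have := eE (kMid c i p).
  have := eE (kTgt (i, scope c i) j (quad_eval p i + shift c i)).
  by rewrite /= => -> -> ->.
by rewrite !inE !(inj_eq io_inj).
Qed.

Lemma gap_path_edges c i j p (e : edge) :
  e \in path_edges gap_graph (io (vSrc c j)) (gap_path c i j p) ->
  e \in [:: edge_of (kSrc c j p); edge_of (kMid c i p);
           edge_of (kTgt (i, scope c i) j (quad_eval p i + shift c i))].
Proof.
by rewrite !inE /= orbF => /or3P[] /eqP eE; apply/or3P;
  [apply: Or31|apply: Or32|apply: Or33]; apply/eqP/val_inj.
Qed.

Lemma gap_feasible : slsn_feasible gap_graph 3 gap_pairs [set: edge].
Proof.
move=> st /mapP[[[c i] j] _ ->] /=; exists (gap_path c i j 0).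
apply: gap_pathP => k; apply/existsP; exists (edge_of k); rewrite inE /=.
exact: eqxx.
Qed.

(** A source is adjacent only to codewords of its constraint and a target only to labels of its
    variable. With at most three edges the path must join the two by a middle edge, which fixes the
    label. *)
Lemma gap_path_decode (S : {set edge}) c i j q :
  short_path (adjS S) 3 (io (vSrc c j)) (io (vTgt (i, scope c i) j)) q ->
  exists p, edge_of (kSrc c j p) \in S /\
    edge_of (kTgt (i, scope c i) j (quad_eval p i + shift c i)) \in S.
Proof.
have adjE a b : adjS S a b -> exists k, edge_of k \in S /\ ends_set k = [set a; b].
  case/existsP=> e /andP[eS /eqP eE]; have [k ek] := edge_ofP e.
  by exists k; rewrite -ek eS -eE ek.
have src b : adjS S (io (vSrc c j)) b ->
    exists p, edge_of (kSrc c j p) \in S /\ b = io (vCon c p).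
  case/adjE=> k [kS /set2_eq[] [e1 e2]]; move: kS e1 e2;
  case: k => [[[[c' i'] p]|[[c' i'] p]]|[[v j'] y]] //= kS.
  - by move=> /io_inj[<- <-] <-; exists p.
  - by move=> /io_inj.
  - by move=> /io_inj.
  - by move=> _ /io_inj.
  - by move=> _ /io_inj.
  - by move=> _ /io_inj.
have tgt v a : adjS S a (io (vTgt v j)) ->
    exists y, edge_of (kTgt v j y) \in S /\ a = io (vVar v y).
  case/adjE=> k [kS /set2_eq[] [e1 e2]]; move: kS e1 e2;
  case: k => [[[[c' i'] p]|[[c' i'] p]]|[[v' j'] y]] //= kS.
  - by move=> _ /io_inj.
  - by move=> _ /io_inj.
  - by move=> <- /io_inj[<- <-]; exists y.
  - by move=> /io_inj.
  - by move=> /io_inj.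
  - by move=> /io_inj.
case/and4P; case: q => [|x1 [|x2 [|x3 [|x4 q]]]] //=.
- by rewrite (inj_eq io_inj).
- by case/andP=> /src[p [_ ->]] _; rewrite (inj_eq io_inj).
- case/and3P=> /src[p [_ ->]] a2 _ /eqP e2; move: a2; rewrite e2.
  by case/tgt=> y [_ /io_inj].
case/and4P=> /src[p [pS ->]] a2 a3 _ /eqP e3 _ _; move: a3; rewrite e3 => /tgt[y [yS e2]].
move: a2; rewrite e2 => /adjE[k [kS /set2_eq[] [h1 h2]]]; move: kS h1 h2;
case: k => [[[[c' i'] p']|[[c' i'] p']]|[[v' j'] y']] //= kS.
- by move=> /io_inj.
- move=> /io_inj[ec ep] /io_inj[ei _ ey]; subst c' p' i'.
  by exists p; rewrite ey.
- by move=> /io_inj.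
- by move=> /io_inj.
- by move=> /io_inj.
- by move=> _ /io_inj.
Qed.

End Instance.

(** * Lower bound on the size of integral solutions *)

Section IntegralCost.
Variables (F : finFieldType) (W : finType) (m : nat) (g : game F W m).
Variables (V : finType) (io : vert F W m -> V).
Hypothesis io_inj : injective io.
Local Notation E := (gap_graph g io).
Local Notation edge_of := (@edge_of F W m g V io).

(* AM-GM, cleared of denominators. *)
Lemma label_tradeoff (K U h h0 : nat) : (K <= U * h -> 2 * K * h0 <= h0 ^ 2 * U + K * h)%N.
Proof.
case: h => [|h] le; first by move: le; rewrite muln0 leqn0 => /eqP ->; lia.
rewrite -(leq_pmul2r (ltn0Sn h)).
apply: (leq_trans (n := K * (h0 ^ 2 + h.+1 ^ 2))%N).
  rewrite (_ : 2 * K * h0 * h.+1 = K * (2 * (h0 * h.+1)))%N; last by lia.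
  by rewrite leq_mul2l (nat_Cauchy h0 h.+1).1 orbT.
rewrite mulnDr mulnDl leq_add //; last by rewrite -mulnA mulnn.
by rewrite mulnC -mulnA leq_mul2l le orbT.
Qed.

(** More than [tau] labels already cost enough. Otherwise the codewords in [U c] together hit all
    |F| positions, so |U c| is at least |F| over the best number of hits; soundness bounds the
    average of the latter by [h0], and AM-GM passes to the sum over constraints. *)
Lemma replica_cost (T : {set F * W * F}) (U : 'I_m -> {set F * F * F}) (tau h0 Q : nat) :
  sound g tau h0 -> (0 < h0)%N -> (Q <= tau)%N -> (Q * h0 <= m * #|F|)%N ->
  (forall c i, exists2 p, p \in U c &
     (i, scope g c i, quad_eval p i + shift g c i) \in T) ->
  (Q <= #|T| + \sum_c #|U c|)%N.
Proof.
move=> snd h0_gt0 leQ leQh cov.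
have [ltT|leT] := ltnP tau #|T|.
  by rewrite (leq_trans leQ) // (leq_trans (ltnW ltT)) // leq_addr.
pose best c := [arg max_(p > (0 : F * F * F)) hits g T c p].
have bestP c p : (hits g T c p <= hits g T c (best c))%N.
  by rewrite /best; case: arg_maxnP => // p' _; apply.
have covc c : (#|F| <= #|U c| * hits g T c (best c))%N.
  rewrite -sum_nat_const.
  apply: (leq_trans (n := \sum_(p in U c) hits g T c p)%N); last exact: leq_sum.
  rewrite -cardsT; apply: leq_trans (card_bigcup_leq _ _); apply: subset_leq_card.
  apply/subsetP => i _; have [p pU h] := cov c i.
  by apply/bigcupP; exists p; rewrite // inE.
have tot : (\sum_(c < m) (2 * #|F| * h0) <= h0 ^ 2 * \sum_c #|U c| + #|F| * (m * h0))%N.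
  apply: (leq_trans (n := \sum_c (h0 ^ 2 * #|U c| + #|F| * hits g T c (best c)))%N).
    by apply: leq_sum => c _; apply: label_tradeoff.
  by rewrite big_split -!big_distrr /= leq_add2l leq_mul2l snd ?orbT.
rewrite sum_nat_const card_ord in tot.
apply: (@leq_trans (\sum_c #|U c|)%N); last exact: leq_addl.
rewrite -(leq_pmul2r h0_gt0) (leq_trans leQh) // -(leq_pmul2r h0_gt0).
move: tot; move: (\sum_c _)%N => s.
have -> : (m * (2 * #|F| * h0) = m * #|F| * h0 + #|F| * (m * h0))%N by lia.
by rewrite leq_add2r -mulnn [(s * h0 * h0)%N]mulnC mulnA [(h0 * s * h0)%N]mulnAC; lia.
Qed.

(** Distinct replicas [j] have disjoint sets of source and target edges, and each replica pays at
    least [Q] on its own. *)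
Lemma slsn_cost (S : {set edge E}) (tau h0 Q : nat) :
  sound g tau h0 -> (0 < h0)%N -> (Q <= tau)%N -> (Q * h0 <= m * #|F|)%N ->
  slsn_feasible E 3 (gap_pairs g io) S -> (#|F| * Q <= #|S|)%N.
Proof.
move=> snd h0_gt0 leQ leQh feas.
pose T j : {set F * W * F} := [set vy | edge_of (kTgt m vy.1 j vy.2) \in S].
pose U j c : {set F * F * F} := [set p | edge_of (kSrc W c j p) \in S].
have rep j : (Q <= #|T j| + \sum_c #|U j c|)%N.
  apply: (replica_cost snd) => // c i.
  have /feas[q] : (io (vSrc W c j), io (vTgt m (i, scope g c i) j)) \in gap_pairs g io.
    by apply/mapP; exists (c, i, j); rewrite ?mem_enum.
  by case/(gap_path_decode io_inj) => p [h1 h2]; exists p; rewrite inE.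
rewrite -sum_nat_const.
apply: (leq_trans (n := \sum_(j : F) (#|T j| + \sum_c #|U j c|))%N).
  by apply: leq_sum => j _; exact: rep.
rewrite -sum1_card big_mkcond (reindex _ (onW_bij _ (edge_of_bij g io_inj))) /=.
rewrite !big_sumType /= big_split /= addnC leq_add //.
  rewrite (leq_trans _ (leq_addr _ _)) // exchange_big /=.
  rewrite pair_bigA /= (eq_bigr (fun cj : 'I_m * F => \sum_p
      if edge_of (kSrc W cj.1 cj.2 p) \in S then 1 else 0)%N).
    by rewrite pair_bigA /=; apply: eq_leq; rewrite [RHS]big_mkcond; apply: eq_bigr => -[[c j] p] _.
  move=> [c j] _; rewrite -sum1_card big_mkcond; apply: eq_bigr => p _.
  by rewrite inE.
apply: (leq_trans (n := \sum_(j : F) \sum_(vy : F * W * F)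
    (if edge_of (kTgt m vy.1 j vy.2) \in S then 1 else 0))%N).
  apply: leq_sum => j _; rewrite -sum1_card big_mkcond leq_sum // => vy _.
  by rewrite inE.
rewrite pair_bigA /=.
rewrite (reindex (fun k : F * W * F * F => (k.1.2, (k.1.1, k.2)))) /=.
  by apply: eq_leq; rewrite [RHS]big_mkcond; apply: eq_bigr => -[[v j] y] _.
by exists (fun jv => (jv.2.1, jv.1, jv.2.2)) => [[[v j] y]|[j [v y]]].
Qed.

End IntegralCost.

(** * The Lasserre solution *)

(** The cut with z = 1, tested at the entry of the empty set. It keeps the SDP value away from 0, so
    that the gap can be bounded below. *)
Lemma lasserre_value_ge1 (R : realType) (V : finType) (E : {set {set V}}) r L
    (pairs : seq (V * V)) (y : {set edge E} -> R) s t :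
  lasserre_feasible r L pairs y -> (s, t) \in pairs -> s != t ->
  1 <= \sum_e y [set e].
Proof.
move=> [_ y0 _ feas] st_in st.
have z1 : @inZ R V E L s t (fun=> 1).
  split=> [e|p]; first by rewrite ler01 lexx.
  case: p => [|a p]; first by rewrite /short_path /= (negbTE st).
  case/and4P=> /= /andP[sa _] _ _ _.
  pose e : edge E := exist _ [set s; a] sa.
  rewrite (bigD1 e) ?ler_wpDr ?sumr_ge0 //.
  by rewrite inE /= eqxx.
have := feas _ st_in _ z1 (fun I => (I == set0)%:R).
rewrite (bigD1 set0) ?cards0 //= (bigD1 set0) ?cards0 //= !eqxx.
rewrite [X in _ + X + _]big1 => [|J /andP[_ /negbTE ->]]; last by rewrite mulr0.
rewrite [X in _ + _ + X]big1 => [|I /andP[_ /negbTE ->]]; last first.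
  by rewrite big1 // => J _; rewrite !mul0r.
rewrite !addr0 mul1r mulr1 setU0 y0 subr_ge0.
by rewrite (eq_bigr (fun e => y [set e])) // => e _; rewrite mul1r setU0.
Qed.

Lemma sum_ge_inj (R : realType) (I J : finType) (h : I -> J) (f : J -> R) :
  injective h -> (forall j, 0 <= f j) -> \sum_i f (h i) <= \sum_j f j.
Proof.
move=> hinj f0.
rewrite -(big_imset f (h := h) (A := mem predT)) /=; last by move=> ? ? _ _; exact: hinj.
by rewrite [X in _ <= X](bigID (mem [set h x | x in predT])) /= lerDl sumr_ge0.
Qed.

Section LasserreSolution.
Variables (R : realType) (F : finFieldType) (psi : F -> R).
Hypothesis psiD : forall x y, psi (x + y) = psi x * psi y.
Hypothesis psi_sq : forall x, psi x ^+ 2 = 1.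
Hypothesis psi_sum : \sum_x psi x = 0.
Variables (W : finType) (m : nat) (g : game F W m) (r : nat).
(** Twice 2 r + 2, the largest size of a union of two indices of the moment matrix, since squares in
    degree n need 2 n <= rho. *)
Let rho := (4 * r + 4)%N.
Hypothesis g_expanding : expanding g (33 * rho).
Hypothesis card_gt2 : (2 < #|F|)%N.
Variables (V : finType) (io : vert F W m -> V).
Hypothesis io_inj : injective io.
Local Notation var := (F * W)%type.
Local Notation chr := {ffun var -> F}.
Local Notation E := (gap_graph g io).
Local Notation edge_of := (@edge_of F W m g V io).
Local Notation pE := (pE psi g rho).
Local Notation spanned := (spanned psi g).

Let rho_gt0 : (0 < rho)%N. Proof. by rewrite /rho; lia. Qed.

(** The edges that an assignment would buy: those of the codeword it induces on each constraint and
    those of the value of each variable, in every replica. *)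
Definition holds (k : kind F W m) (x : chr) : bool :=
  match k with
  | inl (inl (c, _, p)) | inl (inr (c, _, p)) =>
      [forall i, x (i, scope g c i) == quad_eval p i + shift g c i]
  | inr (v, _, y) => x v == y
  end.

Definition event k x : R := (holds k x)%:R.

Lemma spanned_event k : spanned 1 (event k).
Proof.
case: k => [[[[c i] p]|[[c i] p]]|[[v j] y]].
- exact: (spanned_con_event psiD psi_sq psi_sum).
- exact: (spanned_con_event psiD psi_sq psi_sum).
- exact: (spanned_var_event psiD psi_sq psi_sum).
Qed.

Lemma pE1 : pE (fun=> 1) = 1.
Proof.
rewrite -[RHS](pchar0 psiD psi_sq g_expanding) -(pE_chi psiD psi_sq psi_sum).
by apply: eq_pE => x; rewrite (chi0 psiD psi_sq).
Qed.

Lemma var_event_sum (G : chr -> R) v : \sum_y pE (fun x => var_event R v y x * G x) = pE G.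
Proof.
rewrite -pE_sum; apply: eq_pE => x; rewrite -mulr_suml (bigD1 (x v)) //= /var_event eqxx.
by rewrite big1 ?addr0 ?mul1r // => y ne; rewrite eq_sym (negbTE ne).
Qed.

Section Feasible.
Variable kind_of : edge E -> kind F W m.
Hypothesis kind_ofK : cancel kind_of edge_of.
Hypothesis edge_ofK : cancel edge_of kind_of.

Definition conj_event (I : {set edge E}) (x : chr) : R :=
  [forall e in I, holds (kind_of e) x]%:R.

(** Beyond size 2 r + 2 the pseudo-expectation is not controlled, while every entry must lie in
    [0, 1]; hence the cutoff. *)
Definition lasserre_sol (I : {set edge E}) : R :=
  if (#|I| <= 2 * r + 2)%N then pE (conj_event I) else 0.

Lemma conj_event_prod I x : conj_event I x = \prod_(e in I) event (kind_of e) x.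
Proof.
rewrite /conj_event; case: forallP => [h|nh].
  by rewrite big1 // => e eI; have := h e; rewrite eI /event => /= ->.
have [e /andP[eI ne]] : exists e, (e \in I) && ~~ holds (kind_of e) x.
  apply/existsP; rewrite -[X in is_true X]negbK negb_exists; apply/negP => /forallP h.
  by apply: nh => e; apply/implyP => eI; have := h e; rewrite eI /= negbK.
by rewrite (bigD1 e) //= /event (negbTE ne) mul0r.
Qed.

Lemma spanned_conj_event (I : {set edge E}) : spanned #|I| (conj_event I).
Proof.
apply: (spanned_eq (G := fun x => \prod_(e <- enum I) event (kind_of e) x)).
  by move=> x; rewrite conj_event_prod big_enum.
rewrite cardE; elim: (enum I) => [|e s IH].
  by apply: spanned_eq (spanned1 psiD psi_sq g 0) => x; rewrite big_nil.
apply: spanned_eq (spannedM psiD (spanned_event (kind_of e)) IH) => x.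
by rewrite big_cons.
Qed.

Lemma conj_eventU I J x : conj_event (I :|: J) x = conj_event I x * conj_event J x.
Proof.
rewrite /conj_event -natrM mulnb; congr (nat_of_bool _)%:R.
apply/forallP/andP => [h|[/forallP hI /forallP hJ] e].
  by split; apply/forallP => e; apply/implyP => eI; have := h e; rewrite inE eI ?orbT.
by rewrite inE; apply/implyP => /orP[] eI; [have := hI e|have := hJ e]; rewrite eI.
Qed.

Lemma conj_event1 e x : conj_event [set e] x = event (kind_of e) x.
Proof. by rewrite conj_event_prod big_set1. Qed.

(** Reduces each semidefinite condition to the nonnegativity of one pseudo-expectation of a square
    times [Phi]. *)
Lemma lasserre_quad (k : nat) (M : {set edge E} -> {set edge E} -> R) (Phi : chr -> R)
    (xi : {set edge E} -> R) :
  (forall I J : {set edge E}, (#|I| <= k)%N -> (#|J| <= k)%N ->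
     M I J = pE (fun x => Phi x * (conj_event I x * conj_event J x))) ->
  \sum_(I : {set edge E} | (#|I| <= k)%N) \sum_(J : {set edge E} | (#|J| <= k)%N)
      xi I * M I J * xi J =
  pE (fun x => Phi x *
     (\sum_(I : {set edge E} | (#|I| <= k)%N) xi I * conj_event I x) ^+ 2).
Proof.
move=> ME.
transitivity (\sum_(I : {set edge E} | (#|I| <= k)%N) \sum_(J : {set edge E} | (#|J| <= k)%N)
    pE (fun x => (xi I * xi J) * (Phi x * (conj_event I x * conj_event J x)))).
  apply: eq_bigr => I kI; apply: eq_bigr => J kJ; rewrite pEZ ME //; ring.
under eq_bigr do rewrite -pE_sum.
rewrite -pE_sum; apply: eq_pE => x; rewrite expr2 mulr_suml mulr_sumr.
apply: eq_bigr => I _; rewrite !mulr_sumr; apply: eq_bigr => J _; ring.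
Qed.

Lemma spanned_conj_sum k (xi : {set edge E} -> R) :
  spanned k (fun x => \sum_(I : {set edge E} | (#|I| <= k)%N) xi I * conj_event I x).
Proof.
apply: spanned_sum => I kI; apply: spannedZ; apply: spanned_leq kI _.
exact: spanned_conj_event.
Qed.

(** An event is idempotent, so its product with a square is again a square, of degree one higher in
    the factor. *)
Lemma pE_event_ge0 k n (G : chr -> R) : (2 * n + 2 <= rho)%N -> spanned n G ->
  0 <= pE (fun x => event k x * G x ^+ 2).
Proof.
move=> le sG; have -> : pE (fun x => event k x * G x ^+ 2) =
    pE (fun x => (event k x * G x) ^+ 2).
  by apply: eq_pE => x; rewrite exprMn /event; case: (holds k x); rewrite ?expr1n ?expr0n.
apply: (pE_sq_ge0 psiD psi_sq psi_sum g_expanding (n := 1 + n)); first by lia.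
exact: (spannedM psiD (spanned_event k) sG).
Qed.

(** The masses [Q p] of the codewords act as a flow: they are nonnegative and sum to the left side,
    and each of the three edges on the path through [p] carries mass for [p]. The path has z-weight
    at least 1. *)
Lemma lasserre_sol_cut c i j z (G : chr -> R) : spanned r G ->
  inZ 3 (io (vSrc W c j)) (io (vTgt m (i, scope g c i) j)) z ->
  pE (fun x => G x ^+ 2) <= \sum_e z e * pE (fun x => event (kind_of e) x * G x ^+ 2).
Proof.
move=> sG [z01 zP].
set v := (i, scope g c i); pose val p := quad_eval p i + shift g c i.
pose Q p := pE (fun x => con_event R g c p x * G x ^+ 2).
have Q0 p : 0 <= Q p.
  by apply: (pE_event_ge0 (kSrc W c j p) _ sG); rewrite /rho; lia.
have sG2 : spanned (2 * r) (fun x => G x ^+ 2).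
  rewrite mul2n -addnn; apply: spanned_eq (spannedM psiD sG sG) => x.
  by rewrite expr2.
have sumQ : \sum_p Q p = pE (fun x => G x ^+ 2).
  rewrite -[RHS](pE_con psiD psi_sq psi_sum g_expanding _ _ c) //; last first.
    by apply: spanned_leq sG2; rewrite /rho; lia.
  by rewrite -pE_sum; apply: eq_pE => x; rewrite mulr_suml.
(* Inserting the sum over codewords splits the mass of a label among the codewords that take this
   value at [i]. *)
have Qv y : pE (fun x => var_event R v y x * G x ^+ 2) = \sum_(p | val p == y) Q p.
  rewrite -[LHS](pE_con psiD psi_sq psi_sum g_expanding _ _ c) //; last first.
    apply: (spanned_leq (n1 := 1 + 2 * r)); first by rewrite /rho; lia.
    by apply: (spannedM psiD) => //; exact: (spanned_var_event psiD psi_sq psi_sum).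
  rewrite -pE_sum; apply: eq_pE => x; rewrite mulr_suml [RHS]big_mkcond.
  apply: eq_bigr => p _; rewrite mulrA; rewrite /con_event.
  case: forallP => [h|_]; last by rewrite !mul0r; case: ifP.
  by rewrite mul1r /var_event (eqP (h i)); case: ifP => _; rewrite ?mul1r ?mul0r.
pose phi k := z (edge_of k) * pE (fun x => event k x * G x ^+ 2).
have -> : \sum_e z e * pE (fun x => event (kind_of e) x * G x ^+ 2) = \sum_k phi k.
  rewrite (reindex edge_of); last by exists kind_of => k _.
  by apply: eq_bigr => k _; rewrite edge_ofK.
(* The edges on the paths of this pair; the terms of all other edges are nonnegative and are
   dropped. *)
pose h (u : (F * F * F + F * F * F) + F) : kind F W m :=
  match u with
  | inl (inl p) => kSrc W c j p | inl (inr p) => kMid W c i p | inr y => kTgt m v j y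
  end.
have hinj : injective h.
  by move=> [[[[? ?] ?]|[[? ?] ?]]|?] [[[[? ?] ?]|[[? ?] ?]]|?] //= []; do ? move=> ->.
have phi0 k : 0 <= phi k.
  rewrite mulr_ge0 //; first by case/andP: (z01 (edge_of k)).
  by apply: pE_event_ge0 sG; rewrite /rho; lia.
apply: le_trans (sum_ge_inj hinj phi0); rewrite !big_sumType /=.
have -> : \sum_y phi (kTgt m v j y) = \sum_p z (edge_of (kTgt m v j (val p))) * Q p.
  rewrite [RHS](partition_big val predT) //=; apply: eq_bigr => y _.
  rewrite /phi Qv mulr_sumr; apply: eq_bigr => p /eqP <- //.
rewrite -sumQ -!big_split /=; apply: ler_sum => p _.
rewrite /phi -!mulrDl -[X in X <= _]mul1r ler_wpM2r //.
apply: le_trans (zP _ (gap_pathP io_inj (e := adjE E) c i j p (ends_set_in g io))) _.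
set ks := [:: edge_of (kSrc W c j p); edge_of (kMid W c i p); edge_of (kTgt m v j (val p))].
have ks_uniq : uniq ks by rewrite /= !inE !(inj_eq (edge_of_inj io_inj)).
apply: (le_trans (y := \sum_(e <- ks) z e)); last by rewrite !big_cons big_nil addr0 addrA.
rewrite big_uniq //= big_mkcond [X in _ <= X]big_mkcond; apply: ler_sum => e _.
case: ifP => [/(@gap_path_edges _ _ _ g _ io) ->//|_].
by case: ifP => // _; case/andP: (z01 e).
Qed.

Lemma lasserre_sol_feasible : lasserre_feasible r 3 (gap_pairs g io) lasserre_sol.
Proof.
split.
- move=> I; rewrite /lasserre_sol; case: ifP => [le|_]; last by rewrite lexx ler01.
  have sI := spanned_leq le (spanned_conj_event I).
  have sq (G : chr -> R) : spanned (2 * r + 2) G -> 0 <= pE (fun x => G x ^+ 2).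
    by apply: (pE_sq_ge0 psiD psi_sq psi_sum g_expanding); rewrite /rho; lia.
  have i01 x : conj_event I x ^+ 2 = conj_event I x.
    by rewrite /conj_event; case: forallP => _; rewrite ?expr1n ?expr0n.
  apply/andP; split.
    by rewrite (_ : pE _ = pE (fun x => conj_event I x ^+ 2)) ?sq //; apply: eq_pE.
  (* By idempotence 1 - y_I is the pseudo-expectation of a square as well. *)
  rewrite -subr_ge0 -pE1 -pEB (_ : pE _ = pE (fun x => (1 - conj_event I x) ^+ 2)).
    apply: sq; apply: spanned_eq (spannedD (spanned1 psiD psi_sq g _) (spannedZ (-1) sI)) => x.
    by rewrite mulN1r.
  by apply: eq_pE => x; rewrite sqrrB expr1n mulr2n i01 mul1r; ring.
- rewrite /lasserre_sol cards0 leq0n -[RHS]pE1; apply: eq_pE => x.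
  by rewrite conj_event_prod big_set0.
- move=> xi.
  rewrite (lasserre_quad (Phi := fun=> 1)) => [|I J kI kJ]; last first.
    rewrite /lasserre_sol; have := (leq_card_setU I J).1 => leU.
    rewrite (_ : #|I :|: J| <= _)%N; last by lia.
    by apply: eq_pE => x; rewrite mul1r conj_eventU.
  rewrite (_ : pE _ = pE (fun x => (\sum_(I : {set edge E} | (#|I| <= r.+1)%N)
     xi I * conj_event I x) ^+ 2)); last by apply: eq_pE => x; rewrite mul1r.
  apply: (pE_sq_ge0 psiD psi_sq psi_sum g_expanding (n := r.+1)); first by rewrite /rho; lia.
  exact: spanned_conj_sum.
- move=> st /mapP[[[c i] j] _ ->] z /= zZ xi.
  rewrite (lasserre_quad (Phi := fun x => \sum_e z e * event (kind_of e) x - 1)) => [|I J kI kJ].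
    pose G x := \sum_(I : {set edge E} | (#|I| <= r)%N) xi I * conj_event I x.
    have sG : spanned r G by exact: spanned_conj_sum.
    rewrite (_ : pE _ = \sum_e z e * pE (fun x => event (kind_of e) x * G x ^+ 2) -
        pE (fun x => G x ^+ 2)) ?subr_ge0; first exact: lasserre_sol_cut zZ.
    under eq_bigr do rewrite -pEZ.
    rewrite -pE_sum -pEB; apply: eq_pE => x; rewrite mulrBl mul1r mulr_suml.
    by congr (_ - _); apply: eq_bigr => e _; rewrite mulrA.
  have leU := (leq_card_setU I J).1.
  rewrite /lasserre_sol (_ : #|I :|: J| <= _)%N; last by lia.
  transitivity (\sum_e z e * pE (conj_event (e |: (I :|: J))) - pE (conj_event (I :|: J))).
    congr (_ - _); apply: eq_bigr => e _; congr (_ * _).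
    have := (leq_card_setU [set e] (I :|: J)).1; rewrite cards1 => leU'.
    rewrite ifT //; apply: leq_trans leU' _.
    by apply: leq_trans (leq_add (leqnn 1) leU) _; lia.
  under eq_bigr do rewrite -pEZ.
  rewrite -pE_sum -pEB; apply: eq_pE => x; rewrite mulrBl mul1r mulr_suml conj_eventU.
  by congr (_ - _); apply: eq_bigr => e _; rewrite !conj_eventU conj_event1 mulrA.
Qed.

(** The codewords of one constraint have total mass 1, and so do the values of one variable. Hence
    each (c, j), each (c, i) and each (v, j) contributes exactly 1. *)
Lemma lasserre_sol_cost :
  \sum_e lasserre_sol [set e] = (2 * (m * #|F|) + #|F| * #|W| * #|F|)%:R.
Proof.
transitivity (\sum_k pE (event k)).
  rewrite (reindex edge_of); last by exists kind_of => k _.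
  apply: eq_bigr => k _; rewrite /lasserre_sol cards1 (_ : 1 <= _)%N; last by lia.
  by apply: eq_pE => x; rewrite conj_event1 edge_ofK.
have con1 c : \sum_p pE (con_event R g c p) = 1.
  rewrite -[RHS]pE1 -[RHS](pE_con psiD psi_sq psi_sum g_expanding _ _ c) //; last first.
    exact: (spanned1 psiD psi_sq).
  by rewrite -pE_sum; apply: eq_pE => x; rewrite mulr1.
have var1 v : \sum_y pE (var_event R v y) = 1.
  rewrite -[RHS]pE1 -[RHS](var_event_sum _ v); apply: eq_bigr => y _.
  by apply: eq_pE => x; rewrite mulr1.
rewrite !big_sumType /=.
have sumc (T : finType) (f : 'I_m * F * T -> R) : (forall c j, \sum_p f (c, j, p) = 1) ->
    \sum_t f t = (m * #|F|)%:R.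
  move=> f1; transitivity (\sum_(cj : 'I_m * F) \sum_p f (cj, p)).
    by rewrite pair_bigA; apply: eq_bigr => -[].
  rewrite (eq_bigr (fun=> 1)) => [|[c j] _]; last exact: f1.
  by rewrite sumr_const card_prod card_ord.
rewrite !sumc; do ? by move=> c j; exact: con1.
have -> : \sum_(i : var * F * F) pE (event (inr i)) = (#|F| * #|W| * #|F|)%:R.
  transitivity (\sum_(vj : var * F) \sum_y pE (var_event R vj.1 y)).
    by rewrite [RHS]pair_bigA; apply: eq_bigr => -[[v j] y] _.
  by under eq_bigr do rewrite var1; rewrite sumr_const !card_prod.
by rewrite -!natrD addnn mul2n.
Qed.

End Feasible.
End LasserreSolution.

(** * Parameters *)

(* In characteristic 2 the nontrivial additive characters are real. *)
Lemma sign_character (R : realType) (F : finFieldType) : 2 \in [pchar F] ->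
  exists psi : F -> R, [/\ forall x y, psi (x + y) = psi x * psi y,
    forall x, psi x ^+ 2 = 1 & \sum_x psi x = 0].
Proof.
move=> ch2; pose L := pPrimeCharType ch2.
have dimL : (0 < \dim {:L})%N.
  by rewrite lt0n dimv_eq0 -subv0; apply/negP => /subvP/(_ 1 (memvf _)); rewrite memv0 oner_eq0.
(* The sign is read off one coordinate of the field as a vector space over its prime field. *)
pose b := vbasis {:L}; pose i0 := Ordinal dimL.
pose co (x : L) : 'F_2 := coord b i0 x.
pose psi (x : F) : R := if co x == 0 then 1 else -1.
have F2 (u : 'F_2) : u = 0 \/ u = 1.
  by case: u => [[|[|//]] h]; [left|right]; apply: val_inj.
have psiD x y : psi (x + y) = psi x * psi y.
  have coD : co (x + y) = co x + co y by exact: (linearD (coord b i0)).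
  rewrite /psi coD.
  by case: (F2 (co x)) => ->; case: (F2 (co y)) => ->; rewrite /= ?mul1r ?mulr1 ?mulN1r ?opprK.
exists psi; split=> // [x|]; first by rewrite /psi; case: ifP; rewrite ?sqrrN expr1n.
have [x0 nx0] : exists x0, psi x0 = -1.
  exists (b`_i0); rewrite /psi /co coord_free ?eqxx //; exact: (basis_free (vbasisP _)).
(* Translation by a basis vector of sign -1 negates the sum. *)
set s := \sum_x _; have : s = - s.
  rewrite {1}/s (reindex_inj (addrI x0)) -mulN1r /s mulr_sumr.
  by apply: eq_bigr => x _; rewrite psiD nx0.
by move/eqP; rewrite -addr_eq0 -mulr2n mulrn_eq0 /= => /eqP.
Qed.

Lemma sign_field (R : realType) k : (0 < k)%N ->
  exists (F : finFieldType) (psi : F -> R), [/\ #|F| = (2 ^ k)%N,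
    forall x y, psi (x + y) = psi x * psi y,
    forall x, psi x ^+ 2 = 1 & \sum_x psi x = 0].
Proof.
move=> k0; have [F ch2 cF] := pPrimePowerField (isT : prime 2) k0.
by have [psi [h1 h2 h3]] := sign_character R ch2; exists F, psi.
Qed.

Lemma expanding_leq (F : finFieldType) (W : finType) m (g : game F W m) S S' :
  (S' <= S)%N -> expanding g S -> expanding g S'.
Proof. by move=> le eS T leT; apply: eS; exact: leq_trans le. Qed.

Lemma gap_of_game (R : realType) (F : finFieldType) (psi : F -> R) (W : finType) (m r n : nat)
    (g : game F W m) (tau h Q : nat) :
  (forall x y, psi (x + y) = psi x * psi y) -> (forall x, psi x ^+ 2 = 1) ->
  \sum_x psi x = 0 -> (2 < #|F|)%N -> (0 < m)%N ->
  expanding g (33 * (4 * r + 4)) -> sound g tau h ->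
  (0 < h)%N -> (Q <= tau)%N -> (Q * h <= m * #|F|)%N ->
  (#|vert F W m| <= n)%N ->
  exists (E : {set {set 'I_n}}) (pairs : seq ('I_n * 'I_n)),
    [/\ simple_graph E, exists S, slsn_feasible E 3 pairs S &
        (#|F| * Q)%:R / (2 * (m * #|F|) + #|F| * #|W| * #|F|)%:R <=
          integrality_gap R E r 3 pairs].
Proof.
move=> psiD psi_sq psi_sum F3 m0 exp snd h0 leQ leQh cn.
pose io (v : vert F W m) : 'I_n := widen_ord cn (enum_rank v).
have io_inj : injective io by move=> v v' /(congr1 val) /= /ord_inj/enum_rank_inj.
exists (gap_graph g io), (gap_pairs g io); split.
- exact: gap_simple.
- by exists setT; exact: gap_feasible.
have [kind_of edge_ofK kind_ofK] := edge_of_bij g io_inj.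
have feas := lasserre_sol_feasible psiD psi_sq psi_sum exp F3 io_inj kind_ofK edge_ofK.
have cost := lasserre_sol_cost psiD psi_sq psi_sum exp F3 kind_ofK edge_ofK.
set y := lasserre_sol _ _ _ in feas cost.
have val_le : lasserre_value R (gap_graph g io) r 3 (gap_pairs g io) <=
    (2 * (m * #|F|) + #|F| * #|W| * #|F|)%:R.
  rewrite -cost; apply: ge_inf; last by exists y.
  exists 0 => _ [y' [[y01 _ _ _] ->]]; apply: sumr_ge0 => e _.
  by case/andP: (y01 [set e]).
(* Positivity is what turns the upper bound on the SDP value into a lower bound on the quotient. *)
have val_gt0 : 0 < lasserre_value R (gap_graph g io) r 3 (gap_pairs g io).
  apply: (lt_le_trans (y := 1)) => //; apply: lb_le_inf; first by exists (\sum_e y [set e]), y.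
  move=> _ [y' [feas' ->]].
  apply: (lasserre_value_ge1 feas' (s := io (vSrc W (Ordinal m0) 0))
    (t := io (vTgt m (0, scope g (Ordinal m0) 0) 0))).
    by apply/mapP; exists (Ordinal m0, 0, 0); rewrite ?mem_enum.
  by rewrite (inj_eq io_inj).
have opt_ge : (#|F| * Q)%:R <= slsn_opt R (gap_graph g io) 3 (gap_pairs g io).
  apply: lb_le_inf.
    by exists #|[set: edge (gap_graph g io)]|%:R, setT; split => //; exact: gap_feasible.
  move=> _ [S [fS ->]]; rewrite ler_nat; exact: (slsn_cost io_inj snd h0 leQ leQh fS).
rewrite /integrality_gap; apply: ler_pM => //.
by rewrite lef_pV2 // posrE (lt_le_trans val_gt0).
Qed.

(** The exponents of 2 in the union bound for soundness: 432 = 282 + 150 after bounding m by t m,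
    and 4 collects the two remaining terms. *)
Lemma soundness_exponent (j t m u : nat) : (0 < t -> 0 < m -> 432 * j + 4 <= u ->
  2 + (j * 282 * (t * m) + j * 150 * m + 2 * (t * m)) <= m * (u * t))%N.
Proof.
move=> t0 m0 leu.
have mt : (m <= t * m)%N by rewrite leq_pmull.
have tm0 : (0 < t * m)%N by rewrite muln_gt0 t0.
have -> : (m * (u * t) = u * (t * m))%N by rewrite mulnCA [(m * t)%N]mulnC.
apply: (@leq_trans ((432 * j + 4) * (t * m))); last by rewrite leq_mul2r leu orbT.
have : (j * 150 * m <= j * 150 * (t * m))%N by rewrite leq_mul2l mt orbT.
by move: (t * m)%N tm0 => s s0; clear -s0; nia.
Qed.

Lemma soundness_budget (j t m u : nat) : u = (2 ^ j)%N ->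
  (0 < t -> 0 < m -> 432 * j + 4 <= u ->
  4 * ((u ^ 282) ^ (t * m) * (u ^ 150) ^ m * 4 ^ (t * m)) <= 2 ^ (m * (u * t)))%N.
Proof.
move=> uE t0 m0 leu; have uk k l : ((u ^ k) ^ l = 2 ^ (j * k * l))%N by rewrite uE -!expnM mulnA.
have four k : (4 ^ k = 2 ^ (2 * k))%N by rewrite expnM.
rewrite !uk four (_ : 4 = 2 ^ 2)%N // -!expnD leq_pexp2l //.
exact: soundness_exponent.
Qed.

(** Expansion up to size u^2 uses x = u^16 and y = u^8: 50 + 4 + 128 = 182 and 232 + 8 = 15 * 16.
    Soundness has t = u^24 labels per variable and h = u t agreements, the factor u paying for the
    logarithm [j]. All three parts of the SDP cost equal u^282, against an integral cost of
    u^306. *)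
Lemma gap_instance (R : realType) (j u n : nat) : u = (2 ^ j)%N ->
  (0 < j)%N -> (432 * j + 4 <= u)%N -> (4 * u ^ 382 <= n)%N ->
  exists (E : {set {set 'I_n}}) (pairs : seq ('I_n * 'I_n)),
    [/\ simple_graph E, exists S, slsn_feasible E 3 pairs S &
        (u ^ 24)%:R / 3 <= integrality_gap R E u 3 pairs].
Proof.
move=> uE j0 leu len.
have u436 : (436 <= u)%N.
  by apply: leq_trans leu; rewrite -[436%N]/(432 * 1 + 4)%N leq_add2r leq_mul2l.
have u0 : (0 < u)%N by apply: leq_trans u436.
(* At level r = u the required expansion size is 33 * rho with rho = 4 u + 4. *)
have u2 : (33 * (4 * u + 4) <= u ^ 2)%N.
  rewrite -mulnn (leq_trans _ (leq_mul u436 (leqnn u))) //; clear -u436; lia.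
have u4 : (4 <= u)%N by apply: leq_trans u436.
have uX k : (0 < u ^ k)%N by rewrite expn_gt0 u0.
have [F [psi [cF psiD psi_sq psi_sum]]] : exists (F : finFieldType) (psi : F -> R),
    [/\ #|F| = (u ^ 50)%N, forall x y, psi (x + y) = psi x * psi y,
    forall x, psi x ^+ 2 = 1 & \sum_x psi x = 0].
  by rewrite uE -expnM; apply: sign_field; rewrite muln_gt0 j0.
pose W : finType := 'I_(u ^ 182); have cW : #|W| = (u ^ 182)%N by rewrite card_ord.
pose m := (u ^ 232)%N; pose t := (u ^ 24)%N; pose h := (u ^ 25)%N.
have F3 : (2 < #|F|)%N.
  rewrite cF; apply: (@leq_trans u); first exact: ltnW.
  by rewrite -[X in (X <= _)%N]expn1 leq_pexp2l.
have e1 : (#|F| * #|W| * #|F| = u ^ 282)%N by rewrite cF cW -!expnD.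
have e2 : (#|W| * #|F| = m)%N by rewrite cF cW -!expnD.
have e3 : (#|F| ^ 3 = u ^ 150)%N by rewrite cF -expnM.
have e4 : (m * #|F| = u ^ 282)%N by rewrite cF -expnD.
have [g [gexp gsnd]] : exists g : game F W m,
    expanding g (u ^ 2) /\ sound g (t * (#|W| * #|F|)) h.
  apply: (game_exists R (x := (u ^ 16)%N) (y := (u ^ 8)%N)) => //.
  - by rewrite cW.
  - by rewrite cF cW -!expnM -!expnD.
  - by rewrite -expnD -expnM.
  - apply: (@leq_trans (u ^ 3)); last by rewrite leq_pexp2l.
    by rewrite [X in (_ <= X)%N]expnS leq_mul2r u4 orbT.
  - by rewrite e1 e2 e3 /h expnS; apply: soundness_budget uE _ _ leu; apply: uX.
have cV : (#|vert F W m| <= n)%N.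
  apply: leq_trans len; rewrite !card_sum !card_prod card_ord.
  have -> : (m * (#|F| * #|F| * #|F|) = u ^ 382)%N by rewrite cF -!expnD.
  rewrite e1 e4; have : (u ^ 282 <= u ^ 382)%N by rewrite leq_pexp2l.
  by move: (u ^ 282)%N (u ^ 382)%N; clear; lia.
have leQh : (t * (#|W| * #|F|) * h <= m * #|F|)%N.
  by rewrite e2 e4 -!expnD leq_pexp2l.
have [E [pairs [h1 h2 h3]]] := gap_of_game psiD psi_sq psi_sum F3 (uX _)
  (expanding_leq u2 gexp) gsnd (uX _) (leqnn _) leQh cV.
exists E, pairs; split => //; apply: le_trans h3.
rewrite e1 e2 e4; have -> : (#|F| * (t * m) = u ^ 24 * u ^ 282)%N.
  by rewrite cF -!expnD.
have -> : (2 * u ^ 282 + u ^ 282 = 3 * u ^ 282)%N by rewrite -mulSnr.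
move: (u ^ 24)%N (u ^ 282)%N (uX 282) => a b b0.
by rewrite !natrM -mulf_div divff ?mulr1 // pnatr_eq0 -lt0n.
Qed.

Lemma powR_inv_le (R : realType) (a b : R) (k : nat) : (0 < k)%N ->
  0 <= a -> 0 <= b -> a <= b ^+ k -> a `^ (k%:R^-1) <= b.
Proof.
move=> k0 a0 b0 le.
have kn : (k%:R : R) != 0 by rewrite pnatr_eq0 -lt0n.
have -> : b = (b ^+ k) `^ (k%:R^-1) by rewrite -powR_mulrn // -powRrM divff // powRr1.
by apply: ge0_ler_powR; rewrite ?nnegrE ?invr_ge0 ?exprn_ge0.
Qed.

Lemma linear_leq_expn2 j : (13 <= j -> 432 * j + 4 <= 2 ^ j)%N.
Proof.
elim: j => // j IH; rewrite leq_eqVlt => /orP[/eqP <-//|lt].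
by have := IH lt; rewrite expnS; lia.
Qed.

Theorem theorem4 (R : realType) :
  exists c1 c2 : R, 0 < c1 /\ 0 < c2 /\
  forall eps : R, 0 < eps < 1 ->
  exists N : nat, forall n : nat, (N <= n)%N ->
  exists (E : {set {set 'I_n}}) (L : nat) (pairs : seq ('I_n * 'I_n)) (r : nat),
    [/\ simple_graph E,
        exists S, slsn_feasible E L pairs S,
        (n%:R : R) `^ (c1 * eps) <= r%:R &
        (n%:R : R) `^ (16^-1 - c2 * eps) <= integrality_gap R E r L pairs].
Proof.
(* The level 2^j is at least n^(1/384); the gap reaches n^(1/16) itself, so 1 is just some positive
   constant. *)
exists 384%:R^-1, 1; split; first by rewrite invr_gt0.
split=> // eps /andP[eps0 eps1].
(* The final comparison 382 j + 416 <= 384 j holds from j = 208 on. The existential keeps [J]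
   opaque, so that the huge power is not evaluated. *)
have [J J208] : exists J, (208 <= J)%N by exists 208.
exists (2 ^ (382 * J + 2))%N => n leN.
have n0 : (0 < n)%N by apply: leq_trans leN; rewrite expn_gt0.
(* The largest [j] whose instance fits: n lies between 2^(382 j + 2) and 2^(382 j + 384). *)
pose l := trunc_log 2 n; pose j := ((l - 2) %/ 382)%N.
have leJ : (382 * J + 2 <= l)%N by rewrite trunc_log_max.
have [lj1 lj2] : (382 * j + 2 <= l)%N /\ (l.+1 <= 382 * j + 384)%N.
  by rewrite /j; split; lia.
have jJ : (208 <= j)%N by lia.
have len : (4 * (2 ^ j) ^ 382 <= n)%N.
  apply: leq_trans (trunc_logP (isT : 1 < 2)%N n0); rewrite -/l -expnM.
  by rewrite -[4%N]/(2 ^ 2)%N -expnD leq_pexp2l //; lia.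
have nlt : (n <= 2 ^ (382 * j + 384))%N.
  apply: leq_trans (ltnW (trunc_log_ltn n (isT : 1 < 2)%N)) _.
  by rewrite leq_pexp2l.
have j0 : (0 < j)%N by apply: leq_trans jJ.
have j13 : (13 <= j)%N by apply: leq_trans jJ.
have [E [pairs [hS hF hG]]] := gap_instance R erefl j0 (linear_leq_expn2 j13) len.
have n1 : 1 <= n%:R :> R by rewrite ler1n.
exists E, 3, pairs, (2 ^ j)%N; split => //.
  apply: le_trans (_ : n%:R `^ (384%:R^-1) <= _).
    by rewrite ler_powR //; nra.
  apply: powR_inv_le => //; rewrite -natrX ler_nat (leq_trans nlt) // -expnM.
  by rewrite leq_pexp2l //; lia.
apply: le_trans hG; apply: le_trans (_ : n%:R `^ (16%:R^-1) <= _).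
  by rewrite ler_powR //; lra.
apply: powR_inv_le => //.
(* The sixteenth power of the gap is 2^(384 j) / 3^16, and 3 <= 2^2 costs 32 in the exponent. *)
rewrite expr_div_n ler_pdivlMr ?exprn_gt0 // -!natrX -natrM ler_nat.
apply: (@leq_trans (2 ^ (382 * j + 384) * (2 ^ 2) ^ 16)).
  by apply: leq_mul; [exact: nlt|rewrite leq_exp2r].
by rewrite -!expnM -expnD leq_pexp2l //; lia.
Qed.
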